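(* Let $n\ge1$ and let $P,Q\in\mathcal P_{n,n}$ be such that $\mathcal Z_P=\mathcal Z_Q$. Then $P$ is of type A with respect to $\mathcal P_{n,n}$ if and only if $Q$ is of type A with respect to $\mathcal P_{n,n}$.
   Context: $\mathcal P_{n,n}=\mathbb C[X_1,\ldots,X_n,Y_1,\ldots,Y_n]$ is regarded as the complex $*$-algebra with the unique involution such that $X_j^*=Y_j$ for all $j=1,\ldots,n$. For $P\in\mathcal P_{n,n}$, let $\mathcal Z_P=\{z\in\mathbb C^n: P(z,\bar z)=0\}$ and let $(P)$ be the ideal of $\mathcal P_{n,n}$ generated by $P$. A complex linear functional $\Lambda:\mathcal P_{n,n}\to\mathbb C$ is positive definite if $\Lambda(R^*R)\ge0$ for all $R\in\mathcal P_{n,n}$. It is a moment functional if there is a positive Borel measure $\mu$ on $\mathbb C^n$ (with all functions $z\mapsto R(z,\bar z)$, $R\in\mathcal P_{n,n}$, absolutely integrable) such that $\Lambda(R)=\int_{\mathbb C^n}R(z,\bar z)\,d\mu(z)$ for all $R\in\mathcal P_{n,n}$. A polynomial $P\in\mathcal P_{n,n}$ is of type A with respect to $\mathcal P_{n,n}$ if every positive definite linear functional $\Lambda:\mathcal P_{n,n}\to\mathbb C$ with $(P)\subset\ker\Lambda$ is a moment functional. *)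

(* Defs.v *)
From HB Require Import structures.
From mathcomp Require Import all_boot all_order all_algebra.
From mathcomp Require Import all_classical all_reals all_analysis.
From mathcomp Require Import complex.
(* The notations of mpoly clash with those of analysis. *)
From mathcomp Require Import -(notations) mpoly.

Set Implicit Arguments.
Unset Strict Implicit.
Unset Printing Implicit Defensive.

Import Order.TTheory GRing.Theory Num.Theory.
Import numFieldNormedType.Exports.
Local Open Scope classical_set_scope.
Local Open Scope complex_scope.
Local Open Scope ring_scope.

(* C[X_1, ..., X_n, Y_1, ..., Y_n]: the first n of the n + n variables are
   the X_j, the last n are the Y_j. *)
Notation cpoly R n := (mpoly (n + n) R[i]).

(* C^n; R[i]^o is R[i] with the topology of its modulus. *)
Notation cspace R n := 'rV[(R[i])^o]_n.

(* C^n with its Borel sigma-algebra. *)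
Notation cborel R n := (g_sigma_algebraType (@open (cspace R n))).

Section Polynomials.
Variables (R : realType) (n : nat).
Implicit Types (p q : cpoly R n) (z : cspace R n) (c : R[i]).

Definition varX (j : 'I_n) : cpoly R n :=
  mpolyX R[i] (mnm1 (lshift n j)).
Definition varY (j : 'I_n) : cpoly R n :=
  mpolyX R[i] (mnm1 (rshift n j)).

(* The involution: conjugate the coefficients and exchange X_j and Y_j. *)
Definition cstar p : cpoly R n :=
  mmap (@mpolyC (n + n) R[i] \o @conjc R)
    (fun k => match fintype.split k with inl j => varY j | inr j => varX j end) p.

(* p(z, conj z) *)
Definition ceval p z : R[i] :=
  meval
    (fun k => match fintype.split k return R[i] with
              | inl j => z 0 j
              | inr j => (z 0 j : R[i])^*
              end) p.

Definition zero_set p : set (cspace R n) := [set z | ceval p z = 0].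

Definition principal_ideal p : set (cpoly R n) :=
  [set s * p | s in [set: cpoly R n]].

End Polynomials.

Section Functionals.
Variables (R : realType) (n : nat).
Implicit Types (L : {scalar (cpoly R n)}) (P : cpoly R n).

(* In R[i], 0 <= c means that c is real and nonnegative. *)
Definition positive_definite L : Prop :=
  forall p : cpoly R n, 0 <= L (cstar p * p).

Definition cintegral (mu : {measure set (cborel R n) -> \bar R})
    (f : cspace R n -> R[i]) : R[i] :=
  Rintegral mu setT (fun z => complex.Re (f z))
    +i* Rintegral mu setT (fun z => complex.Im (f z)).

Definition moment_functional L : Prop :=
  exists mu : {measure set (cborel R n) -> \bar R},
    (forall p : cpoly R n,
       mu.-integrable setT (fun z => (ComplexField.Normc.normc (ceval p z))%:E)) /\
    (forall p : cpoly R n, L p = cintegral mu (ceval p)).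

Definition type_A P : Prop :=
  forall L : {scalar (cpoly R n)},
    positive_definite L ->
    principal_ideal P `<=` [set p | L p = 0] ->
    moment_functional L.

End Functionals.

Section Involution.
Variables (R : realType) (n : nat).
Implicit Types (p q : cpoly R n) (c : R[i]).

Lemma cstarX (j : 'I_n) : cstar (varX R j) = varY R j.
Proof.
rewrite /cstar /varX mmapX mmap1U; case: split_ordP => k.
  by move/lshift_inj ->.
by move/eqP; rewrite eq_lrshift.
Qed.

Lemma cstarY (j : 'I_n) : cstar (varY R j) = varX R j.
Proof.
rewrite /cstar /varY mmapX mmap1U; case: split_ordP => k.
  by move/eqP; rewrite eq_rlshift.
by move/rshift_inj ->.
Qed.

Lemma cstar0 : @cstar R n 0 = 0.
Proof. exact: mmap0. Qed.

Lemma cstar1 : @cstar R n 1 = 1.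
Proof. by rewrite /cstar rmorph1. Qed.

Lemma cstarD p q : cstar (p + q) = cstar p + cstar q.
Proof. exact: mmapD. Qed.

Lemma cstarM p q : cstar (p * q) = cstar p * cstar q.
Proof. by rewrite /cstar rmorphM. Qed.

Lemma cstarZ c p : cstar (c *: p) = c^* *: cstar p.
Proof. by rewrite /cstar mmapZ /= mul_mpolyC. Qed.

(* Failed unification between nested cstar terms is very slow if cstar unfolds. *)
#[local] Opaque cstar.

(* At most one conjugate-linear involution maps each X_j to Y_j. *)
Lemma cstar_unique (f : cpoly R n -> cpoly R n) :
    (forall p q, f (p + q) = f p + f q) ->
    (forall c p, f (c *: p) = c^* *: f p) ->
    (forall p q, f (p * q) = f q * f p) ->
    (forall p, f (f p) = p) ->
    (forall j, f (varX R j) = varY R j) ->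
  f =1 @cstar R n.
Proof.
move=> fD fZ fM fK fX.
have f1 : f 1 = 1 by rewrite -[LHS]mul1r -{1}[1]fK -fM mul1r fK.
have f0 : f 0 = 0 by rewrite -[0 in LHS](scale0r 0) fZ rmorph0 scale0r.
have fY j : f (varY R j) = varX R j by rewrite -fX fK.
have fv (k : 'I_(n + n)) : f (mpolyX R[i] (mnm1 k)) = cstar (mpolyX R[i] (mnm1 k)).
  rewrite -[k]splitK; case: (fintype.split k) => j /=.
    by rewrite fX cstarX.
  by rewrite fY cstarY.
have fXm p k : f p = cstar p -> f (p ^+ k) = cstar (p ^+ k).
  move=> e; elim: k => [|k ih]; first by rewrite !expr0 f1 cstar1.
  by rewrite [in LHS]exprS exprSr fM cstarM ih e.
apply: mpolyind => [|c m p _ _ ih]; first by rewrite f0 cstar0.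
rewrite fD cstarD ih fZ cstarZ; congr (_ *: _ + _).
rewrite mpolyXE_id; elim/big_ind: _ => [|p1 p2 e1 e2|k _].
- by rewrite f1 cstar1.
- by rewrite fM cstarM e1 e2; exact: mulrC.
- exact/fXm/fv.
Qed.

Lemma cstarK : involutive (@cstar R n).
Proof.
elim/mpolyind => [|c m p _ _ ih]; first by rewrite cstar0 cstar0.
rewrite !cstarD !cstarZ; congr (_ *: _ + _); [exact: conjcK | | exact: ih].
rewrite mpolyXE_id; elim/big_ind: _ => [|p1 p2 e1 e2|k _].
- by rewrite cstar1 cstar1.
- by rewrite !cstarM; congr (_ * _); [exact: e1 | exact: e2].
elim: (m k) => [|l il]; first by rewrite expr0 cstar1 cstar1.
rewrite exprS !cstarM; congr (_ * _); last exact: il.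
rewrite -[k]splitK; case: (fintype.split k) => j /=.
  by rewrite cstarX cstarY.
by rewrite cstarY cstarX.
Qed.

End Involution.

(* Main.v *)
(* By the symmetry of the statement it suffices that a positive definite L
   vanishing on the ideal (Q) also vanishes on (P) when Z_Q is contained in Z_P.
   The kernel N = {p | L(u p) = 0 for all u} is a real *-ideal: a sum of hermitian
   squares lies in N only if each summand does (Cauchy-Schwarz).  If P were not in
   N, then, after replacing the coefficients of P and Q by variables, the
   polynomials congruent modulo N to sums of hermitian squares would form a
   precone in a countable polynomial ring A over the rationals, in which no
   -|P|^(2k) lies.  A maximal such precone is a prime cone; it yields a real
   closed field S and a morphism A -> S sending Q to 0 and |P|^2 to a positive
   element.  By quantifier elimination the system Q = 0, |P|^2 > 0 is then solvable
   over the reals for the original coefficients, so Z_Q is not contained in Z_P. *)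
From HB Require Import structures.
Require Import Defs.
From mathcomp Require Import all_boot all_order all_algebra.
From mathcomp Require Import all_classical all_reals all_analysis.
From mathcomp Require Import complex.
From mathcomp Require Import -(notations) mpoly.
From mathcomp Require Import closed_field generic_quotient ring_quotient fraction.
From mathcomp Require Import ordered_qelim qe_rcf_th qe_rcf.
From mathcomp Require Import ring lra zify.

Set Implicit Arguments.
Unset Strict Implicit.
Unset Printing Implicit Defensive.

Import Order.TTheory GRing.Theory Num.Theory.
Local Open Scope classical_set_scope.
Local Open Scope quotient_scope.
Local Open Scope ring_scope.

(** The field [S] is built from a countable ring and need not contain the reals, so the elimination
    has to run over [rat], with real numbers that express the coefficients of [P] and [Q] as
    parameters. Transfer then requires that every rational polynomial in the parameters has the same
    sign in [S] and in [R]. Nonnegativity passes to [S] because a nonnegative real is a square in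
    [R], hence a hermitian square in [cpoly R n]; strict positivity passes because [R] is
    archimedean. The real closure is found inside an algebraically closed field [K], as a maximal
    order on a subfield of [K]: a polynomial over it that changes sign has a root in [K] to whose
    adjunction the order extends, so by maximality the root already lies in the subfield. *)

(** * Quantifier elimination commutes with field embeddings *)

Section MapFormula.
Variables (F F' : realFieldType) (f : {rmorphism F -> F'}).

Fixpoint tm_map (t : term F) : term F' :=
  match t with
  | Var i => Var _ i
  | Const c => Const (f c)
  | NatConst n => NatConst _ n
  | Add u v => Add (tm_map u) (tm_map v)
  | Opp u => Opp (tm_map u)
  | NatMul u n => NatMul (tm_map u) n
  | Mul u v => Mul (tm_map u) (tm_map v)
  | Exp u n => Exp (tm_map u) n
  end.

Fixpoint qf_map (p : formula F) : formula F' :=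
  match p with
  | qe_rcf.Bool b => qe_rcf.Bool b
  | Equal u v => Equal (tm_map u) (tm_map v)
  | Lt u v => Lt (tm_map u) (tm_map v)
  | Le u v => Le (tm_map u) (tm_map v)
  | And p q => And (qf_map p) (qf_map q)
  | Or p q => Or (qf_map p) (qf_map q)
  | Implies p q => Implies (qf_map p) (qf_map q)
  | Not p => Not (qf_map p)
  end.

Notation tms_map := (map tm_map).

Lemma qf_map_If b p q : qf_map (If b p q) = If (qf_map b) (qf_map p) (qf_map q).
Proof. by []. Qed.

Lemma qf_map_Size p k : qf_map (Size p k) = Size (tms_map p) (qf_map \o k).
Proof.
elim: p k => [|c p ih] k //=; rewrite /bind_def ih; congr Size.
by apply/funext => -[|n].
Qed.

Lemma qf_map_Isnull p k : qf_map (Isnull p k) = Isnull (tms_map p) (qf_map \o k).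
Proof. exact: qf_map_Size. Qed.

(** A continuation that takes a number or a Boolean is handled by [qf_map \o k]; one that takes
    terms needs its own counterpart [k'] over [F'], since [tm_map] need not be onto. *)
Lemma qf_map_LeadCoef p k k' : (forall x, qf_map (k x) = k' (tm_map x)) ->
  qf_map (LeadCoef p k) = LeadCoef (tms_map p) k'.
Proof.
elim: p k k' => [|c p ih] k k' kk /=; first by rewrite kk /= rmorph0.
by rewrite /bind_def; apply: ih => x; rewrite qf_map_If !kk.
Qed.

Lemma tms_map_AmulXn a n : tms_map (AmulXn a n) = AmulXn (tm_map a) n.
Proof. by elim: n => //= n ->; rewrite rmorph0. Qed.

Lemma tms_map_AddPoly p q : tms_map (AddPoly p q) = AddPoly (tms_map p) (tms_map q).
Proof. by elim: p q => //= a p ih [|b q] //=; rewrite ih. Qed.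

Lemma tms_map_ScalPoly c p : tms_map (ScalPoly c p) = ScalPoly (tm_map c) (tms_map p).
Proof. by rewrite /ScalPoly -!map_comp. Qed.

Lemma tms_map_MulPoly p q : tms_map (MulPoly p q) = MulPoly (tms_map p) (tms_map q).
Proof. by elim: p => //= a p ih; rewrite tms_map_AddPoly tms_map_ScalPoly /= ih. Qed.

Lemma tms_map_ExpPoly p n : tms_map (ExpPoly p n) = ExpPoly (tms_map p) n.
Proof.
rewrite /ExpPoly; case: n => [|n] //; rewrite !iteropS.
by elim: n => //= n ih; rewrite tms_map_MulPoly ih.
Qed.

Lemma tms_map_OppPoly p : tms_map (OppPoly p) = OppPoly (tms_map p).
Proof. by rewrite /OppPoly tms_map_ScalPoly /= rmorphN1. Qed.

Lemma tms_map_NatMulPoly n p : tms_map (NatMulPoly n p) = NatMulPoly n (tms_map p).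
Proof. exact: tms_map_ScalPoly. Qed.

Lemma tms_map_Deriv p : tms_map (Deriv p) = Deriv (tms_map p).
Proof. by elim: p => //= a p ih; rewrite tms_map_AddPoly /= ih. Qed.

Definition tms_mapE := (tms_map_AmulXn, tms_map_AddPoly, tms_map_ScalPoly,
  tms_map_MulPoly,
  tms_map_ExpPoly, tms_map_OppPoly, tms_map_NatMulPoly, tms_map_Deriv).

Lemma qf_map_Rediv_rec_loop q sq cq c qq r n k k' :
  (forall c qq r, qf_map (k (c, qq, r)) = k' (c, tms_map qq, tms_map r)) ->
  qf_map (Rediv_rec_loop q sq cq c qq r n k) =
  Rediv_rec_loop (tms_map q) sq (tm_map cq) c (tms_map qq) (tms_map r) n k'.
Proof.
elim: n c qq r k k' => [|n ih] c qq r k k' kk /=; rewrite /bind_def qf_map_Size;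
  congr Size; apply/funext => sr /=; case: ifP => // _;
  apply: qf_map_LeadCoef => lr.
  by rewrite kk !tms_mapE.
by rewrite (ih _ _ _ _ _ kk) !tms_mapE.
Qed.

Lemma qf_map_Rediv p q k k' :
  (forall c qq r, qf_map (k (c, qq, r)) = k' (c, tms_map qq, tms_map r)) ->
  qf_map (Rediv p q k) = Rediv (tms_map p) (tms_map q) k'.
Proof.
move=> kk; rewrite /Rediv /bind_def qf_map_Isnull; congr Isnull.
apply/funext => -[] /=; first by rewrite kk /= rmorph0.
rewrite qf_map_Size; congr Size; apply/funext => sq /=.
rewrite qf_map_Size; congr Size; apply/funext => sp /=.
apply: qf_map_LeadCoef => lq.
by rewrite (qf_map_Rediv_rec_loop _ _ _ _ _ _ _ kk) /= rmorph0.
Qed.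

Lemma qf_map_Rmod p q k k' : (forall r, qf_map (k r) = k' (tms_map r)) ->
  qf_map (Rmod p q k) = Rmod (tms_map p) (tms_map q) k'.
Proof. by move=> kk; apply: qf_map_Rediv => c qq r; rewrite kk. Qed.

Lemma qf_map_Rscal p q k : qf_map (Rscal p q k) = Rscal (tms_map p) (tms_map q)
  (qf_map \o k).
Proof. exact: qf_map_Rediv. Qed.

Lemma qf_map_Rgcd_loop n p q k k' : (forall r, qf_map (k r) = k' (tms_map r)) ->
  qf_map (Rgcd_loop n p q k) = Rgcd_loop n (tms_map p) (tms_map q) k'.
Proof.
elim: n p q k k' => [|n ih] p q k k' kk /=; rewrite /bind_def;
  apply: qf_map_Rmod => r; rewrite qf_map_Isnull; congr Isnull;
  by apply/funext => -[] //=; exact: ih.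
Qed.

Lemma qf_map_Rgcd p q k k' : (forall r, qf_map (k r) = k' (tms_map r)) ->
  qf_map (Rgcd p q k) = Rgcd (tms_map p) (tms_map q) k'.
Proof.
move=> kk; rewrite /Rgcd /LtSize /bind_def.
rewrite qf_map_Size; congr Size; apply/funext => sq /=.
rewrite qf_map_Size; congr Size; apply/funext => sp /=.
by case: ifP => _; rewrite qf_map_Isnull; congr Isnull; apply/funext => -[] //=;
  rewrite qf_map_Size; congr Size; apply/funext => n /=; exact: qf_map_Rgcd_loop.
Qed.

Lemma qf_map_BigRgcd ps k k' : (forall r, qf_map (k r) = k' (tms_map r)) ->
  qf_map (BigRgcd ps k) = BigRgcd (map tms_map ps) k'.
Proof.
elim: ps k k' => [|p ps ih] k k' kk /=; first by rewrite kk /= rmorph0.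
by rewrite /bind_def; apply: ih => r; exact: qf_map_Rgcd.
Qed.

Lemma qf_map_Changes s k : qf_map (Changes s k) = Changes (tms_map s) (qf_map \o k).
Proof.
elim: s k => [|a s ih] k //=; rewrite /bind_def ih; congr Changes.
by apply/funext => v; rewrite /comp qf_map_If /=; case: (s).
Qed.

Lemma qf_map_SeqPInfty ps k k' : (forall r, qf_map (k r) = k' (tms_map r)) ->
  qf_map (SeqPInfty ps k) = SeqPInfty (map tms_map ps) k'.
Proof.
elim: ps k k' => [|p ps ih] k k' kk /=; first by rewrite kk.
by rewrite /bind_def; apply: qf_map_LeadCoef => l; apply: ih => r; rewrite kk.
Qed.

Lemma qf_map_SeqMInfty ps k k' : (forall r, qf_map (k r) = k' (tms_map r)) ->
  qf_map (SeqMInfty ps k) = SeqMInfty (map tms_map ps) k'.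
Proof.
elim: ps k k' => [|p ps ih] k k' kk /=; first by rewrite kk.
rewrite /bind_def; apply: qf_map_LeadCoef => l; rewrite qf_map_Size; congr Size.
by apply/funext => sp /=; apply: ih => r; rewrite kk /= rmorphN1.
Qed.

Lemma qf_map_ChangesPoly ps k :
  qf_map (ChangesPoly ps k) = ChangesPoly (map tms_map ps) (qf_map \o k).
Proof.
rewrite /ChangesPoly /bind_def; apply: qf_map_SeqMInfty => m.
apply: qf_map_SeqPInfty => p; rewrite qf_map_Changes; congr Changes.
by apply/funext => v /=; rewrite qf_map_Changes.
Qed.

Lemma qf_map_NextMod p q k k' : (forall r, qf_map (k r) = k' (tms_map r)) ->
  qf_map (NextMod p q k) = NextMod (tms_map p) (tms_map q) k'.
Proof.
move=> kk; rewrite /NextMod /bind_def; apply: qf_map_LeadCoef => l.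
rewrite qf_map_Rscal; congr Rscal; apply/funext => s /=.
by apply: qf_map_Rmod => r; rewrite kk tms_mapE.
Qed.

Lemma qf_map_ModsAux p q n k k' : (forall r, qf_map (k r) = k' (map tms_map r)) ->
  qf_map (ModsAux p q n k) = ModsAux (tms_map p) (tms_map q) n k'.
Proof.
elim: n p q k k' => [|n ih] p q k k' kk /=; first by rewrite kk.
rewrite /bind_def qf_map_Isnull; congr Isnull; apply/funext => -[] /=.
  by rewrite kk.
by apply: qf_map_NextMod => r; apply: ih => s; rewrite kk.
Qed.

Lemma qf_map_Mods p q k k' : (forall r, qf_map (k r) = k' (map tms_map r)) ->
  qf_map (Mods p q k) = Mods (tms_map p) (tms_map q) k'.
Proof.
move=> kk; rewrite /Mods /bind_def.
rewrite qf_map_Size; congr Size; apply/funext => sq /=.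
rewrite qf_map_Size; congr Size; apply/funext => sp /=.
exact: qf_map_ModsAux.
Qed.

Lemma tms_map_PolyComb sq sc : tms_map (PolyComb sq sc) = PolyComb (map tms_map sq) sc.
Proof.
rewrite /PolyComb size_map; elim: (iota 0 (size sq)) => //= i s ih.
rewrite tms_mapE ih; congr MulPoly; rewrite tms_mapE; congr ExpPoly.
by rewrite -[[::] in RHS]/(tms_map [::]); elim: (sq) (i) => [|a l IH] [|j] //=.
Qed.

Lemma tms_map_Pcq sq i : tms_map (Pcq sq i) = Pcq (map tms_map sq) i.
Proof.
rewrite /Pcq size_map; elim: (sg_tab _) i => [|a s ih] [|i] //=.
exact: tms_map_PolyComb.
Qed.

Lemma qf_map_TaqR p q k : qf_map (TaqR p q k) = TaqR (tms_map p) (tms_map q)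
  (qf_map \o k).
Proof.
rewrite /TaqR /bind_def -tms_map_Deriv -tms_map_MulPoly; apply: qf_map_Mods => r.
by rewrite qf_map_ChangesPoly.
Qed.

Lemma qf_map_TaqsR p sq i k k' : (forall x, qf_map (k x) = k' (tm_map x)) ->
  qf_map (TaqsR p sq i k) = TaqsR (tms_map p) (map tms_map sq) i k'.
Proof.
move=> kk; rewrite /TaqsR /bind_def -tms_map_Pcq qf_map_TaqR; congr TaqR.
by apply/funext => x /=; rewrite kk /= rmorph_int.
Qed.

(** These coefficients, which recover a count of roots from Tarski queries, come from the inverse of
    an integer matrix; they are rational and hence fixed by field morphisms. *)
Lemma tm_map_Coefs n i : tm_map (Coefs F n i) = Coefs F' n i.
Proof.
rewrite /Coefs /=; congr Const; case: n => [|[|n]].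
- by rewrite rmorph_nat.
- by case: i => [|[|[|i]]] /=; rewrite ?fmorphV ?rmorph_nat ?rmorph0 ?nth_nil ?rmorph0.
have [lt_i|le_i] := ltnP i (3 ^ n.+2); last first.
  by rewrite /coefs !nth_default ?rmorph0 // size_map size_enum_ord.
have i0 : 'I_(3 ^ n.+2) by rewrite exp3n; exact: ord0.
rewrite /coefs !(nth_map i0) -?enumT ?size_enum_ord //.
have -> : map_mx (intmul 1) (ctmat n.+2) = map_mx f (map_mx (intmul 1) (ctmat n.+2)).
  by apply/matrixP => u v; rewrite !mxE rmorph_int.
by rewrite -map_invmx -map_castmx mxE.
Qed.

Lemma qf_map_CcountWeak p sq k k' : (forall x, qf_map (k x) = k' (tm_map x)) ->
  qf_map (CcountWeak p sq k) = CcountWeak (tms_map p) (map tms_map sq) k'.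
Proof.
rewrite /CcountWeak size_map => kk; rewrite -[NatConst F' 0]/(tm_map (NatConst F 0)).
elim: (3 ^ _)%N (NatConst F 0) k k' kk => [|n ih] s k k' kk //=.
rewrite /bind_def; by apply: qf_map_TaqsR => x; rewrite (ih _ _ _ kk) -tm_map_Coefs.
Qed.

Lemma qf_map_bigAnd (I : Type) (r : seq I) (G : I -> formula F) :
  qf_map (reducebig (qe_rcf.Bool true) r (fun i => BigBody i (@And _) true (G i))) =
  reducebig (qe_rcf.Bool true) r (fun i => BigBody i (@And _) true (qf_map (G i))).
Proof. by elim: r => //= i r ->. Qed.

Lemma qf_map_CcountGt0 sp sq :
  qf_map (CcountGt0 sp sq) = CcountGt0 (map tms_map sp) (map tms_map sq).
Proof.
rewrite /CcountGt0 /bind_def; apply: qf_map_BigRgcd => p.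
rewrite qf_map_Isnull; congr Isnull; apply/funext => -[] /=; last first.
  exact: qf_map_CcountWeak.
(* When all equations vanish identically, solutions of the strict inequalities are sought near both
   infinities, by leading coefficients and sizes, and at the roots of the derivative of the product
   of [sq]. *)
have -> : BoundingPoly (map tms_map sq) = tms_map (BoundingPoly sq).
  by rewrite /BoundingPoly tms_mapE; congr Deriv; elim: sq => //= q s ->;
    rewrite tms_mapE.
apply: qf_map_CcountWeak => c /=; rewrite !qf_map_bigAnd; congr (Or _ (Or _ _)).
  elim: sq => //= q s ->; congr And.
  exact: qf_map_LeadCoef.
elim: sq => //= q s ->; congr And; rewrite qf_map_Size; congr Size.
by apply/funext => n /=; exact: qf_map_LeadCoef.
Qed.

Lemma tms_map_abstrX i t : tms_map (abstrX i t) = abstrX i (tm_map t).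
Proof.
elim: t => //= [n|u ihu v ihv|u ihu|u ihu n|u ihu v ihv|u ihu n];
  rewrite ?tms_mapE ?ihu ?ihv //.
by case: ifP.
Qed.

End MapFormula.

(** * Transfer between real closed fields *)

Section Transfer.

(* Running the elimination over [rat] yields a single formula that is valid in
   all real closed fields at once. *)
Definition rat_eval (S : realFieldType) (e : seq S) (t : term rat) : S :=
  eval e (tm_map (@ratr S) t).
Definition rat_holds (S : realFieldType) (e : seq S) (p : formula rat) : bool :=
  qf_eval e (qf_map (@ratr S) p).

Lemma eq_rat_eval (S : realFieldType) (e e' : seq S) t :
  (forall i, e`_i = e'`_i) -> rat_eval e t = rat_eval e' t.
Proof.
move=> ee; rewrite /rat_eval.
by elim: t => //= [u -> v ->|u ->|u -> n|u -> v ->|u -> n].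
Qed.

Lemma eq_rat_holds (S : realFieldType) (e e' : seq S) p :
  (forall i, e`_i = e'`_i) -> rat_holds e p = rat_holds e' p.
Proof.
move=> ee; have := eq_rat_eval _ ee; rewrite /rat_eval /rat_holds => E.
by elim: p => //= [u v|u v|u v|p -> q ->|p -> q ->|p -> q ->|p ->] //; rewrite !E.
Qed.

(** Every atom compares the difference of two terms with zero, and zero is what is neither positive
    nor negative, so the positivity of all terms decides the formula, even across two different
    fields. *)
Lemma sgr_rat_holds (S S' : realFieldType) (e : seq S) (e' : seq S') p :
  (forall t, (0 < rat_eval e t) = (0 < rat_eval e' t)) ->
  rat_holds e p = rat_holds e' p.
Proof.
move=> h.
have hB u v : (rat_eval e u < rat_eval e v) = (rat_eval e' u < rat_eval e' v).
  have := h (Add v (Opp u)); rewrite /rat_eval /= => hh.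
  by rewrite -subr_gt0 hh subr_gt0.
rewrite /rat_holds; rewrite /rat_eval in hB.
elim: p => //= [u v|u v|p -> q ->|p -> q ->|p -> q ->|p ->] //.
  by rewrite !eq_le !leNgt !hB.
by rewrite !leNgt hB.
Qed.

(** Equations and strict inequalities, the shape of system that [CcountGt0] decides. *)
Definition clause := (seq (term rat) * seq (term rat))%type.
Definition clause_holds (S : realFieldType) (e : seq S) (c : clause) : bool :=
  all (fun t => rat_eval e t == 0) c.1 && all (fun t => 0 < rat_eval e t) c.2.
Definition dnf_holds (S : realFieldType) (e : seq S) (cs : seq clause) : bool :=
  has (clause_holds e) cs.
Definition dnf_and (cs ds : seq clause) : seq clause :=
  [seq (c.1 ++ d.1, c.2 ++ d.2) | c <- cs, d <- ds].

Lemma dnf_holds_cat (S : realFieldType) (e : seq S) cs ds :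
  dnf_holds e (cs ++ ds) = dnf_holds e cs || dnf_holds e ds.
Proof. exact: has_cat. Qed.

Lemma dnf_holds_and (S : realFieldType) (e : seq S) cs ds :
  dnf_holds e (dnf_and cs ds) = dnf_holds e cs && dnf_holds e ds.
Proof.
rewrite /dnf_and; elim: cs => //= c cs ih.
rewrite dnf_holds_cat ih andb_orl; congr orb.
rewrite /dnf_holds has_map /=; elim: ds {ih} => [|d ds ih] /=; first by rewrite andbF.
rewrite ih andb_orr; congr orb; rewrite /clause_holds /= !all_cat.
by rewrite andbACA.
Qed.

(** The Boolean [b] is the truth value wanted of [p]; carrying it along pushes negations down to the
    atoms, where they become strict inequalities or equations. *)
Fixpoint dnf (b : bool) (p : formula rat) : seq clause :=
  match p with
  | qe_rcf.Bool c => if c == b then [:: ([::], [::])] else [::]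
  | Equal u v => let t := Add u (Opp v) in
      if b then [:: ([:: t], [::])] else [:: ([::], [:: t]); ([::], [:: Opp t])]
  | Lt u v => let t := Add v (Opp u) in
      if b then [:: ([::], [:: t])] else [:: ([:: t], [::]); ([::], [:: Opp t])]
  | Le u v => let t := Add v (Opp u) in
      if b then [:: ([:: t], [::]); ([::], [:: t])] else [:: ([::], [:: Opp t])]
  | And p q => if b then dnf_and (dnf b p) (dnf b q) else dnf b p ++ dnf b q
  | Or p q => if b then dnf b p ++ dnf b q else dnf_and (dnf b p) (dnf b q)
  | Implies p q => if b then dnf false p ++ dnf b q else dnf_and (dnf true p) (dnf b q)
  | Not p => dnf (~~ b) p
  end.

Lemma dnfP (S : realFieldType) (e : seq S) b p :
  dnf_holds e (dnf b p) = (rat_holds e p == b).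
Proof.
rewrite /rat_holds; elim: p b => [c|u v|u v|u v|p ihp q ihq|p ihp q ihq|p ihp q ihq|p ihp] b /=.
- by case: ifP.
- case: b; rewrite /dnf_holds /clause_holds /= /rat_eval /= !(andbT, orbF) ?subr_gt0 //.
    by rewrite subr_eq0 eqb_id.
  by rewrite oppr_gt0 subr_lt0 eqbF_neg neq_lt orbC.
- case: b; rewrite /dnf_holds /clause_holds /= /rat_eval /= !(andbT, orbF) ?subr_gt0 //.
    by rewrite eqb_id.
  by rewrite subr_eq0 oppr_gt0 subr_lt0 eqbF_neg -leNgt le_eqVlt.
- case: b; rewrite /dnf_holds /clause_holds /= /rat_eval /= !(andbT, orbF) ?subr_gt0 //.
    by rewrite subr_eq0 eqb_id le_eqVlt eq_sym.
  by rewrite oppr_gt0 subr_lt0 eqbF_neg -ltNge.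
- case: b; rewrite ?dnf_holds_cat ?dnf_holds_and ihp ihq ?eqb_id ?eqbF_neg //.
  by rewrite negb_and.
- case: b; rewrite ?dnf_holds_cat ?dnf_holds_and ihp ihq ?eqb_id ?eqbF_neg //.
  by rewrite negb_or.
- case: b; rewrite ?dnf_holds_cat ?dnf_holds_and ihp ihq ?eqb_id ?eqbF_neg //.
    by rewrite implybE.
  by rewrite negb_imply.
- by rewrite ihp; case: b; case: qf_eval.
Qed.

Definition qe1 (i : nat) (p : formula rat) : formula rat :=
  foldr (fun c q => Or (CcountGt0 (map (abstrX i) c.1) (map (abstrX i) c.2)) q)
        (qe_rcf.Bool false) (dnf true p).

(** The existential quantifier distributes over the clauses, and [CcountGt0] decides each of them as
    a univariate system in variable [i]. *)
Lemma qe1P (S : rcfType) (e : seq S) i p :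
  rat_holds e (qe1 i p) <-> exists x, rat_holds (set_nth 0 e i x) p.
Proof.
have -> : (exists x, rat_holds (set_nth 0 e i x) p) <->
    exists x, dnf_holds (set_nth 0 e i x) (dnf true p).
  by split=> -[x]; [move=> h; exists x; rewrite dnfP h | rewrite dnfP eqb_id; exists x].
rewrite /qe1 /rat_holds; elim: (dnf true p) => [|c cs ih] /=.
  by split=> // -[].
have C : qf_eval e (qf_map ratr (CcountGt0 (map (abstrX i) c.1) (map (abstrX i) c.2)))
    <-> exists x, clause_holds (set_nth 0 e i x) c.
  rewrite qf_map_CcountGt0 eval_CcountGt0 -!map_comp.
  apply: (iff_trans (iff_sym (rwP (ccount_gt0P _ _)))).
  suff E x : clause_holds (set_nth 0 e i x) c =
      \big[andb/true]_(q <- map (eval_poly e \o (map (tm_map (@ratr S)) \o abstrX i)) c.1) (q.[x] == 0)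
      && \big[andb/true]_(q <- map (eval_poly e \o (map (tm_map (@ratr S)) \o abstrX i)) c.2) (0 < q.[x]).
    by split=> -[x h]; exists x; [rewrite E | rewrite -E].
  rewrite !big_all !all_map; congr (_ && _);
    by apply: eq_all => t /=; rewrite tms_map_abstrX abstrXP.
split=> [/orP[/C[x h]|/ih[x h]]|[x /orP[h|h]]].
- by exists x; rewrite /dnf_holds /= h.
- by exists x; rewrite /dnf_holds /= orbC; apply/orP; left.
- by apply/orP; left; apply/C; exists x.
- by apply/orP; right; apply/ih; exists x.
Qed.

Lemma qeP d p : exists q, forall (S : rcfType) (e : seq S), rat_holds e q <->
  exists e1 : seq S, (forall j, (d <= j)%N -> e1`_j = e`_j) /\ rat_holds e1 p.
Proof.
elim: d p => [|d ih] p.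
  exists p => S e; split=> [h|[e1 [ee h]]]; first by exists e.
  by rewrite -(eq_rat_holds p (fun i => ee i isT)).
have [q hq] := ih (qe1 d p); exists q => S e; rewrite hq.
split=> [[e1 [ee /qe1P[x h]]]|[e1 [ee h]]].
  exists (set_nth 0 e1 d x); split=> // j dj.
  by rewrite nth_set_nth /= gtn_eqF // ee // ltnW.
(* The outer value is put back at index [d]; the value that [e1] has there becomes the witness for
   [qe1 d p]. *)
exists (set_nth 0 e1 d e`_d); split=> [j|].
  by rewrite nth_set_nth /=; case: eqVneq => [->//|nj] dj;
    rewrite ee // ltn_neqAle eq_sym nj.
apply/qe1P; exists e1`_d; rewrite (@eq_rat_holds _ _ e1) // => i.
by rewrite nth_set_nth /= nth_set_nth /=; case: eqVneq => [->|].
Qed.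

Lemma rcf_transfer (S S' : rcfType) d p (e e1 : seq S) (e' : seq S') :
  (forall t, (0 < rat_eval e t) = (0 < rat_eval e' t)) ->
  (forall j, (d <= j)%N -> e1`_j = e`_j) -> rat_holds e1 p ->
  exists e1' : seq S', (forall j, (d <= j)%N -> e1'`_j = e'`_j) /\ rat_holds e1' p.
Proof.
move=> ee e1e h; have [q hq] := qeP d p.
by apply/hq; rewrite -(sgr_rat_holds _ ee); apply/hq; exists e1.
Qed.

End Transfer.

(** * Prime cones *)

(* Properties of pairs of elements pass to unions of chains. *)
Lemma Zorn_extension (T : Type) (good : set T -> Prop) (T0 : set T) :
  good T0 ->
  (forall U, T0 `<=` U ->
    (forall x y, U x -> U y -> exists X, [/\ good X, X `<=` U, X x & X y]) -> good U) ->
  exists M, [/\ good M, T0 `<=` M & forall X, good X -> M `<=` X -> X `<=` M].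
Proof.
move=> gT0 gU.
(* Each set is joined with [T0], so that the union of the empty chain is good as well. *)
have [F Fgood Ftot|X [gX maxX]] := @Zorn_bigcup T (fun X => good (X `|` T0)).
  have [->|/set0P[X0 FX0]] := eqVneq F set0; first by rewrite bigcup_set0 set0U.
  have one x : (\bigcup_(X in F) X `|` T0) x -> exists2 X, F X & (X `|` T0) x.
    by move=> [[X FX Xx]|T0x]; [exists X => //; left | exists X0 => //; right].
  have sub X : F X -> X `|` T0 `<=` \bigcup_(X in F) X `|` T0.
    by move=> FX x [Xx|T0x]; [left; exists X|right].
  apply: gU => [x|x y /one[X FX Xx] /one[Y FY Yy]]; first by right.
  have [XY|YX] := Ftot X Y FX FY; [exists (Y `|` T0)|exists (X `|` T0)].
    by split=> //; [exact: Fgood|exact: sub|case: Xx; [left; exact: XY|right]].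
  by split=> //; [exact: Fgood|exact: sub|case: Yy; [left; exact: YX|right]].
exists (X `|` T0); split=> // Y gY XY a Ya; left; apply: contrapT => nXa.
apply: (maxX Y); last by rewrite setUidl //; apply: subset_trans XY => x; right.
by split=> [x Xx|/(_ a Ya)//]; apply: XY; left.
Qed.

Section PrimeCone.
Variable A : comNzRingType.
Implicit Types (T : set A) (a b s : A).

Record precone T : Prop := Precone {
  preconeD : forall a b, T a -> T b -> T (a + b);
  preconeM : forall a b, T a -> T b -> T (a * b);
  precone_sqr : forall a, T (a ^+ 2) }.

Lemma precone1 T : precone T -> T 1.
Proof. by move=> PT; rewrite -(expr1n _ 2); exact: precone_sqr. Qed.

Lemma precone0 T : precone T -> T 0.
Proof. by move=> PT; have := precone_sqr PT 0; rewrite expr0n. Qed.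

Lemma preconeX T a k : precone T -> T a -> T (a ^+ k).
Proof.
move=> PT Ta; elim: k => [|k ih]; first by rewrite expr0; exact: precone1.
by rewrite exprS; exact: preconeM.
Qed.

(** The exclusion of [- s ^+ k] serves as properness: [k = 0] keeps -1 out, [k = 1] makes [s]
    strictly positive in the final order, and taking all powers lets two such relations be
    multiplied. *)
Lemma precone_maximal T0 s : precone T0 -> (forall k, ~ T0 (- s ^+ k)) ->
  exists T, [/\ precone T, T0 `<=` T, forall k, ~ T (- s ^+ k) &
    forall T', precone T' -> T `<=` T' -> (forall k, ~ T' (- s ^+ k)) -> T' `<=` T].
Proof.
move=> PT0 sT0.
have [||M [[PM sM] T0M Mmax]] :=
    @Zorn_extension A (fun X => precone X /\ forall k, ~ X (- s ^+ k)) T0.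
- by [].
- move=> U T0U pairs; split=> [|k Uk]; last first.
    by have [X [[_ sX] _ Xk _]] := pairs _ _ Uk Uk; exact: (sX k).
  split=> [a b Ua Ub|a b Ua Ub|a].
  + by have [X [[PX _] XU Xa Xb]] := pairs _ _ Ua Ub; apply: XU; exact: preconeD.
  + by have [X [[PX _] XU Xa Xb]] := pairs _ _ Ua Ub; apply: XU; exact: preconeM.
  + by apply: T0U; exact: precone_sqr.
- by exists M; split=> // T' PT' MT' sT'; exact: Mmax.
Qed.

(** A maximal [T] omits [a] only because [T + a T] contains some [- s ^+ k]. Totality, and primality
    of the support (the intersection of [T] and [- T]), both come from multiplying two relations of
    this kind. *)
Lemma prime_cone T0 s : precone T0 -> T0 s -> (forall k, ~ T0 (- s ^+ k)) ->
  exists T, [/\ precone T, T0 `<=` T, forall k, ~ T (- s ^+ k),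
    forall a, T a \/ T (- a) &
    forall a b, T (a * b) -> T (- (a * b)) -> (T a /\ T (- a)) \/ (T b /\ T (- b))].
Proof.
move=> PT0 T0s /(precone_maximal PT0)[T [PT T0T sT maxT]].
have Ts k : T (s ^+ k) by apply: preconeX => //; exact: T0T.
have ext a : ~ T a -> exists k t u, [/\ T t, T u & - s ^+ k = t + a * u].
  move=> nTa; apply: contrapT => nex; apply: nTa.
  pose T' := [set x | exists t u, [/\ T t, T u & x = t + a * u]].
  have T0' : T 0 by exact: precone0.
  have TT' : T `<=` T' by move=> t Tt; exists t, 0; rewrite mulr0 addr0.
  apply: (maxT T') => //.
  - split=> [x y [t [u [Tt Tu ->]]] [t' [u' [Tt' Tu' ->]]]
            |x y [t [u [Tt Tu ->]]] [t' [u' [Tt' Tu' ->]]]|x].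
    + by exists (t + t'), (u + u'); split; [exact: preconeD|exact: preconeD|ring].
    + exists (t * t' + a ^+ 2 * (u * u')), (t * u' + u * t'); split; last by ring.
        by apply: preconeD => //; apply: preconeM => //;
          [exact: precone_sqr | exact: preconeM].
      by apply: preconeD => //; exact: preconeM.
    + by apply: TT'; exact: precone_sqr.
  - by move=> k [t [u [Tt Tu e]]]; apply: nex; exists k, t, u.
  - by exists 0, 1; rewrite mulr1 add0r; split=> //; exact: precone1.
have tot a : T a \/ T (- a).
  have [Ta|/ext[k [t [u [Tt Tu e]]]]] := pselect (T a); first by left.
  have [Ta|/ext[l [v [w [Tv Tw e']]]]] := pselect (T (- a)); first by right.
  exfalso; apply: (sT (k + l)%N).
  (* This is the product of [s ^+ k + t = - (a * u)] and [s ^+ l + v = a * w]. *)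
  have -> : - s ^+ (k + l) = a ^+ 2 * (u * w) + (s ^+ k * v + t * s ^+ l + t * v).
    have E1 : s ^+ k = - (t + a * u) by rewrite -e opprK.
    have E2 : s ^+ l = - (v + (- a) * w) by rewrite -e' opprK.
    by rewrite exprD E1 E2; ring.
  apply: (preconeD PT); first by apply: (preconeM PT);
    [exact: precone_sqr|exact: preconeM].
  by apply: (preconeD PT); [apply: (preconeD PT)|]; exact: preconeM.
exists T; split=> // a b Tab nTab.
have [[Ta nTa]|na] := pselect (T a /\ T (- a)); first by left.
have [[Tb nTb]|nb] := pselect (T b /\ T (- b)); first by right.
(* Outside the support, [c] or [- c] has a multiple by an element of [T] of the form [s ^+ k + t].
   The product of two such multiples, for [a] and [b], again puts a [- s ^+ (k + l)] into [T]. *)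
have key c : ~ (T c /\ T (- c)) -> exists c' k t u,
    [/\ c' = c \/ c' = - c, T t, T u & s ^+ k + t = c' * u].
  move=> nc; have [Tc|/ext[k [t [u [Tt Tu e]]]]] := pselect (T c); last first.
    by exists (- c), k, t, u; split=> //; [right|rewrite -[s ^+ k]opprK e; ring].
  have /ext[k [t [u [Tt Tu e]]]] : ~ T (- c) by move=> Tc'; exact: nc.
  by exists c, k, t, u; split=> //; [left|rewrite -[s ^+ k]opprK e; ring].
have [a' [k [t [u [aa Tt Tu E1]]]]] := key a na.
have [b' [l [v [w [bb Tv Tw E2]]]]] := key b nb.
exfalso; apply: (sT (k + l)%N).
have -> : - s ^+ (k + l) =
    (- (a' * b')) * (u * w) + (s ^+ k * v + t * s ^+ l + t * v).
  have -> : - (a' * b') * (u * w) = - ((a' * u) * (b' * w)) by ring.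
  by rewrite -E1 -E2 exprD; ring.
have Tab' : T (- (a' * b')).
  by case: aa bb => -> [] ->; rewrite ?(mulNr, mulrN, opprK).
apply: (preconeD PT); first by apply: (preconeM PT) => //; exact: preconeM.
by apply: (preconeD PT); [apply: (preconeD PT)|]; exact: preconeM.
Qed.

(** Applied to [a] and to [- a], this makes the support of a total precone an ideal. *)
Lemma precone_support T a b : precone T -> (forall a, T a \/ T (- a)) ->
  T a -> T (- a) -> T (a * b).
Proof.
move=> PT tot Ta nTa; case: (tot b) => [Tb|nTb]; first exact: preconeM.
by rewrite -mulrNN; exact: preconeM.
Qed.

End PrimeCone.

(** * Orderings extend along sign changes *)

Section SignChange.
Variable F : realFieldType.
Implicit Types (p q h : {poly F}) (s : seq (F * {poly F})).

(** The weights are there because a nonnegative element of [F] need not be a square: with them the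
    cone extends the given order of [F]. *)
Definition wsos s : {poly F} := \sum_(x <- s) x.1 *: x.2 ^+ 2.
Definition nneg_weights s := all (fun x => 0 <= x.1) s.

Lemma wsos_cat s t : wsos (s ++ t) = wsos s + wsos t.
Proof. exact: big_cat. Qed.

Lemma wsos_mul s t :
  wsos [seq (x.1 * y.1, x.2 * y.2) | x <- s, y <- t] = wsos s * wsos t.
Proof.
rewrite /wsos big_allpairs_dep /= big_distrl /=; apply: eq_bigr => x _.
rewrite big_distrr /=; apply: eq_bigr => y _.
by rewrite exprMn -scalerA -scalerAl -scalerAr.
Qed.

Lemma nneg_weights_mul s t : nneg_weights s -> nneg_weights t ->
  nneg_weights [seq (x.1 * y.1, x.2 * y.2) | x <- s, y <- t].
Proof.
move=> /allP hs /allP ht; apply/allP => _ /allpairsP[[x y] [/= /hs hx /ht hy ->]] /=.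
exact: mulr_ge0.
Qed.

Lemma wsos_ge0 s a : nneg_weights s -> 0 <= (wsos s).[a].
Proof.
move=> /allP hs; rewrite /wsos horner_sum big_seq sumr_ge0 // => x /hs hx.
by rewrite hornerZ horner_exp mulr_ge0 // sqr_ge0.
Qed.

(* Artin-Schreier descent: once the squared polynomials are reduced modulo [q],
   the cofactor [h] has smaller degree than [q] and changes sign as well. *)
Lemma sign_change_ndvd_wsos q h a b s : q.[a] * q.[b] < 0 -> nneg_weights s ->
  q * h <> 1 + wsos s.
Proof.
have [n] := ubnP (size q); elim: n => // n ih in q h s *.
rewrite ltnS => sq qab ws E.
have q0 : q != 0 by apply: contraTneq qab => ->; rewrite !horner0 mul0r ltxx.
have sq2 : (1 < size q)%N.
  rewrite ltnNge; apply/negP => /size1_polyC qC; move: qab.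
  by rewrite qC !hornerC -expr2 ltNge sqr_ge0.
pose s' := [seq (x.1, x.2 %% q) | x <- s].
have ws' : nneg_weights s' by rewrite /nneg_weights all_map.
have [H HE] : exists H, wsos s = wsos s' + q * H.
  rewrite /wsos big_map /=; elim: (s) => [|x t [H HE]].
    by exists 0; rewrite !big_nil mulr0 addr0.
  exists (x.1 *: ((x.2 %/ q) ^+ 2 * q + (x.2 %/ q) * (x.2 %% q) *+ 2) + H).
  rewrite !big_cons HE {1}(divp_eq x.2 q) mulrDr addrACA; congr (_ + _).
  by rewrite -scalerAr -scalerDr; congr (_ *: _); ring.
set h' := h - H; have {E HE} E : q * h' = 1 + wsos s'.
  by rewrite /h' mulrBr E HE; ring.
(* Since [q * h'] is positive everywhere, [h'] has the sign of [q] at [a] and at [b]. *)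
have pos x : 0 < (q * h').[x].
  by rewrite E hornerD hornerC ltr_wpDr // wsos_ge0.
have h'0 : h' != 0 by apply: contraTneq (pos 0) => ->; rewrite mulr0 horner0 ltxx.
(* Remainders modulo [q] have degree at most [size q - 2], which doubles under squaring. *)
have sW : (size (1 + wsos s')%R <= (size q).-2.*2.+1)%N.
  apply: (leq_trans (size_polyD _ _)); rewrite geq_max size_poly1 /=.
  rewrite /wsos big_map; apply: (leq_trans (size_sum _ _ _)).
  apply/bigmax_leqP_seq => x _ _ /=.
  apply: (leq_trans (size_scale_leq _ _)).
  have := size_poly_exp_leq (x.2 %% q) 2; have := ltn_modpN0 x.2 q0.
  by move: sq2; set u := size _; set v := size _; set w := size _; lia.
have sh : (size h' < n)%N.
  move: sW; rewrite -E size_mul //.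
  by move: h'0 sq sq2; rewrite -size_poly_gt0; set u := size _; set v := size _; lia.
apply: (ih h' q s') => //; last by rewrite mulrC.
have := mulr_gt0 (pos a) (pos b); rewrite !hornerM => pab.
move: qab pab; move: q.[a] q.[b] h'.[a] h'.[b] => x y z t h1 h2.
have -> : z * t = (x * z * (y * t)) / (x * y).
  by field; apply/andP; split; apply: contraTneq h1 => ->; rewrite ?(mul0r, mulr0) ltxx.
by rewrite pmulr_rlt0 // invr_lt0.
Qed.

(** The nonnegative constants, the squares and the ideal of [q] generate a precone; -1 in it would
    make a multiple of [q] equal to [1 + wsos s]. Then [prime_cone] applies with [s = 1]. *)
Lemma sign_change_cone q a b : q.[a] * q.[b] < 0 -> exists T : set {poly F},
  [/\ precone T, forall c, 0 <= c -> T c%:P, T q /\ T (- q), ~ T (- 1) &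
   (forall p, T p \/ T (- p)) /\
   forall p p', T (p * p') -> T (- (p * p')) -> (T p /\ T (- p)) \/ (T p' /\ T (- p'))].
Proof.
move=> qab; pose T0 := [set p | exists s h, nneg_weights s /\ p = wsos s + q * h].
have T0c c p : 0 <= c -> T0 (c *: p ^+ 2).
  move=> c0; exists [:: (c, p)], 0; rewrite /nneg_weights /= c0; split=> //.
  by rewrite /wsos big_seq1 mulr0 addr0.
have T0q p : T0 (q * p).
  by exists [::], p; split=> //; rewrite /wsos big_nil add0r.
have PT0 : precone T0.
  split=> [x y [s [h [ws ->]]] [t [k [wt ->]]]|x y [s [h [ws ->]]] [t [k [wt ->]]]|x].
  - exists (s ++ t), (h + k); split; first by rewrite /nneg_weights all_cat; apply/andP.
    by rewrite wsos_cat; ring.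
  - exists [seq (x.1 * y.1, x.2 * y.2) | x <- s, y <- t],
      (h * wsos t + wsos s * k + h * (q * k)).
    by split; [exact: nneg_weights_mul | rewrite wsos_mul; ring].
  - by rewrite -[_ ^+ 2]scale1r; exact: T0c.
have T01 : T0 1 by have := T0c 1 1 ler01; rewrite expr1n scale1r.
have nT0 k : ~ T0 (- 1 ^+ k).
  rewrite expr1n => -[s [h [ws E]]].
  apply: (sign_change_ndvd_wsos (h := - h) qab ws); rewrite mulrN.
  by rewrite -[1]opprK E; ring.
have [T [PT sub nT tot prm]] := prime_cone PT0 T01 nT0.
exists T; split=> //; first by move=> c c0; apply: sub; have := T0c c 1 c0;
  rewrite expr1n alg_polyC.
  by split; apply: sub; [rewrite -[q]mulr1|rewrite -mulrN1]; exact: T0q.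
by have := nT 0%N; rewrite expr0.
Qed.

(* [y] is a root of an element of least degree in the support of [T]. *)
Lemma cone_root (K : closedFieldType) (j : {rmorphism F -> K}) (T : set {poly F}) q :
  precone T -> ~ T (- 1) -> (forall p, T p \/ T (- p)) ->
  (forall p p', T (p * p') -> T (- (p * p')) -> (T p /\ T (- p)) \/ (T p' /\ T (- p'))) ->
  T q -> T (- q) -> q != 0 ->
  exists y, forall g, (map_poly j g).[y] = 0 <-> T g /\ T (- g).
Proof.
move=> PT nT tot prm Tq nTq q0; pose I p := T p /\ T (- p).
have IM p g : I p -> I (p * g).
  by move=> [h1 h2]; split; rewrite -?mulNr; apply: precone_support; rewrite ?opprK.
have ID p g : I p -> I g -> I (p + g).
  by move=> [h1 h2] [h3 h4]; split; rewrite ?opprD; exact: preconeD.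
have : exists n, `[< exists r, [/\ I r, r != 0 & size r = n] >].
  by exists (size q); apply/asboolP; exists q; split.
move=> /ex_minnP[n /asboolP[r [Ir r0 sr]] rmin].
have min g : I g -> g != 0 -> (size r <= size g)%N.
  by move=> Ig g0; rewrite sr; apply: rmin; apply/asboolP; exists g.
have sr1 : (1 < size r)%N.
  rewrite ltnNge; apply/negP => /size1_polyC rC; apply: nT.
  have c0 : r`_0 != 0 by apply: contra_neq r0 => c0; rewrite rC c0.
  have [] := IM _ (- (r`_0)^-1%:P) Ir; rewrite {1}rC mulrN -polyCM divff //.
have [y ry] : exists y, root (map_poly j r) y.
  have : size (map_poly j r) != 1%N by rewrite size_map_poly neq_ltn sr1 orbT.
  by move/closed_rootP.
exists y => g; split=> [gy|[Tg nTg]].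
  (* The common root [y] gives the gcd of [g] and [r] positive degree. By primality the gcd or its
     cofactor [u] in [r] lies in the support, and [u] is too small to do so. *)
  have gcd0 : gcdp g r != 0 by rewrite gcdp_eq0 negb_and r0 orbT.
  have [u ru] : exists u, r = gcdp g r * u.
    by have /dvdpP[u E] := dvdp_gcdr g r; exists u; rewrite mulrC.
  have [v gv] : exists v, g = gcdp g r * v.
    by have /dvdpP[v E] := dvdp_gcdl g r; exists v; rewrite mulrC.
  have sg1 : (1 < size (gcdp g r))%N.
    rewrite -(size_map_poly j) gcdp_map; apply: (@root_size_gt1 _ y).
      by rewrite -gcdp_map map_poly_eq0.
    by rewrite root_gcd ry andbT; exact/rootP.
  suff : I (gcdp g r) by move=> /(IM _ v); rewrite -gv.
  have [||//|Iu] := prm (gcdp g r) u; [by rewrite -ru; exact: Ir.1|by rewrite -ru;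
    exact: Ir.2|].
  have u0 : u != 0 by apply: contra_neq r0 => u0; rewrite ru u0 mulr0.
  have := min _ Iu u0; rewrite {1}ru size_mul //; move: sg1.
  by set m := size _; set l := size _; lia.
have Im : I (g %% r).
  have -> : g %% r = g + r * (- (g %/ r)) by rewrite {2}(divp_eq g r); ring.
  by apply: ID; [|exact: IM].
have : g %% r == 0.
  by apply/negPn/negP => m0; have := min _ Im m0; rewrite leqNgt ltn_modp r0.
move=> /eqP m0; rewrite (divp_eq g r) m0 addr0 rmorphM hornerM.
by rewrite (rootP ry) mulr0.
Qed.

End SignChange.

(** * Real closure inside an algebraically closed field *)

Section OrderCone.
Variable K : fieldType.
Implicit Types (P : set K) (x y : K).

(** Totality is asked only of differences of elements of [P]: the subring [P - P] is what gets
    ordered, whereas [K], algebraically closed in the application, admits no order. *)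
Record order_cone P : Prop := OrderCone {
  order_coneD : forall x y, P x -> P y -> P (x + y);
  order_coneM : forall x y, P x -> P y -> P (x * y);
  order_cone1 : P 1;
  order_cone_anti : forall x, P x -> P (- x) -> x = 0;
  order_cone_total : forall x y, P x -> P y -> P (x - y) \/ P (y - x) }.

Lemma order_cone0 P : order_cone P -> P 0.
Proof.
by move=> hP; have [] := order_cone_total hP (order_cone1 hP) (order_cone1 hP);
  rewrite subrr.
Qed.

Lemma order_cone_maximal P : order_cone P -> exists M, [/\ order_cone M, P `<=` M &
  forall P', order_cone P' -> M `<=` P' -> P' `<=` M].
Proof.
move=> hP; apply: Zorn_extension => // U PU pairs; split.
- move=> x y Ux Uy; have [X [hX XU Xx Xy]] := pairs _ _ Ux Uy.
  by apply: XU; exact: order_coneD.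
- move=> x y Ux Uy; have [X [hX XU Xx Xy]] := pairs _ _ Ux Uy.
  by apply: XU; exact: order_coneM.
- by apply: PU; exact: order_cone1.
- move=> x Ux Uy; have [X [hX XU Xx Xy]] := pairs _ _ Ux Uy.
  exact: (order_cone_anti hX).
- move=> x y Ux Uy; have [X [hX XU Xx Xy]] := pairs _ _ Ux Uy.
  by have [h|h] := order_cone_total hX Xx Xy; [left|right]; exact: XU.
Qed.

(** The order extends to fractions, so a maximal cone is closed under inverses and orders a
    subfield. *)
Lemma order_cone_fractions P : order_cone P ->
  order_cone [set z | exists x y, [/\ P x, P y, y != 0 & z = x / y]].
Proof.
move=> hP; have PD := order_coneD hP; have PM := order_coneM hP.
have P0 := order_cone0 hP.
split.
- move=> _ _ [x [y [Px Py y0 ->]]] [x' [y' [Px' Py' y0' ->]]].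
  exists (x * y' + x' * y), (y * y').
  by split; [apply: PD; exact: PM|exact: PM|exact: mulf_neq0|field; rewrite y0 y0'].
- move=> _ _ [x [y [Px Py y0 ->]]] [x' [y' [Px' Py' y0' ->]]].
  exists (x * x'), (y * y').
  by split; [exact: PM|exact: PM|exact: mulf_neq0|field; rewrite y0 y0'].
- by exists 1, 1; rewrite divr1 oner_eq0; split=> //; exact: order_cone1.
- move=> _ [x [y [Px Py y0 ->]]] [x' [y' [Px' Py' y0' E]]].
  suff -> : x = 0 by rewrite mul0r.
  have E' : x * y' = - (x' * y).
    have -> : x' = - (x / y) * y' by rewrite E; field.
    by field.
  have xy0 : x * y' = 0 by apply: (order_cone_anti hP); [exact: PM|rewrite E' opprK;
    exact: PM].
  by apply/eqP; move/eqP: xy0; rewrite mulf_eq0 (negbTE y0') orbF.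
- move=> _ _ [x [y [Px Py y0 ->]]] [x' [y' [Px' Py' y0' ->]]].
  have [h|h] := order_cone_total hP (PM _ _ Px Py') (PM _ _ Px' Py); [left|right].
    exists (x * y' - x' * y), (y * y'); split; [by []|exact: PM|exact: mulf_neq0|].
    by field; rewrite y0 y0'.
  exists (x' * y - x * y'), (y * y'); split; [by []|exact: PM|exact: mulf_neq0|].
  by field; rewrite y0 y0'.
Qed.

End OrderCone.

(* The nonnegative part of an ordered subfield of [K]. *)
Record field_cone (K : fieldType) := FieldCone {
  fc_set :> K -> Prop;
  fcP : order_cone fc_set;
  fcV : forall x, fc_set x -> fc_set x^-1 }.

Definition fc_pred (K : fieldType) (P : field_cone K) : pred K :=
  fun x => `[< P x \/ P (- x) >].

(** * The ordered subfield carried by a cone *)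

Section ConeField.
Variables (K : fieldType) (P : field_cone K).

Lemma fc_pred_closed : divring_closed (fc_pred P).
Proof.
have hP := fcP P.
split.
- by apply/asboolP; left; exact: order_cone1.
- move=> x y /asboolP hx /asboolP hy; apply/asboolP.
  case: hx hy => hx [hy|hy].
  + by rewrite opprB; exact: order_cone_total.
  + by left; exact: order_coneD.
  + by right; rewrite opprB addrC; exact: order_coneD.
  + have [] := order_cone_total hP hx hy; rewrite opprK addrC => h.
      by right; rewrite opprB.
    by left.
- move=> x y /asboolP hx /asboolP hy; apply/asboolP.
  case: hx hy => hx [/fcV hy|/fcV hy].
  + by left; exact: order_coneM.
  + by right; rewrite -mulrN -invrN; exact: order_coneM.
  + by right; rewrite -mulNr; exact: order_coneM.
  + by left; rewrite -mulrNN -invrN; exact: order_coneM.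
Qed.

HB.instance Definition _ := GRing.isDivringClosed.Build K (fc_pred P) fc_pred_closed.

Record cone_field := ConeField { cf_val : K; _ : cf_val \in fc_pred P }.
HB.instance Definition _ := [isSub for cf_val].
HB.instance Definition _ := [Choice of cone_field by <:].
HB.instance Definition _ := [SubChoice_isSubIntegralDomain of cone_field by <:].
HB.instance Definition _ := [SubIntegralDomain_isSubField of cone_field by <:].

Lemma cf_valD : {morph (val : cone_field -> K) : x y / x + y}.
Proof. exact: (rmorphD (val : cone_field -> K)). Qed.
Lemma cf_valB : {morph (val : cone_field -> K) : x y / x - y}.
Proof. exact: (rmorphB (val : cone_field -> K)). Qed.
Lemma cf_valM : {morph (val : cone_field -> K) : x y / x * y}.
Proof. exact: (rmorphM (val : cone_field -> K)). Qed.
Lemma cf_val0 : val (0 : cone_field) = 0.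
Proof. exact: (rmorph0 (val : cone_field -> K)). Qed.

Definition cf_le (x y : cone_field) : bool := `[< P (val y - val x) >].

Lemma cf_le0E x : cf_le 0 x = `[< P (val x) >].
Proof. by rewrite /cf_le cf_val0 subr0. Qed.

Lemma cf_le0D x y : cf_le 0 x -> cf_le 0 y -> cf_le 0 (x + y).
Proof.
rewrite !cf_le0E cf_valD => /asboolP hx /asboolP hy; apply/asboolP.
exact: (order_coneD (fcP P)).
Qed.

Lemma cf_le0M x y : cf_le 0 x -> cf_le 0 y -> cf_le 0 (x * y).
Proof.
rewrite !cf_le0E cf_valM => /asboolP hx /asboolP hy; apply/asboolP.
exact: (order_coneM (fcP P)).
Qed.

Lemma cf_le0_anti x : cf_le 0 x -> cf_le x 0 -> x = 0.
Proof.
rewrite cf_le0E /cf_le cf_val0 sub0r => /asboolP hx /asboolP hy.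
by apply: val_inj; rewrite cf_val0; exact: (order_cone_anti (fcP P)).
Qed.

Lemma cf_sub_ge0 x y : cf_le 0 (y - x) = cf_le x y.
Proof. by rewrite cf_le0E cf_valB. Qed.

Lemma cf_le0_total x : cf_le 0 x || cf_le x 0.
Proof.
rewrite cf_le0E /cf_le cf_val0 sub0r; have /asboolP := valP x.
by case=> h; apply/orP; [left|right]; exact/asboolP.
Qed.

Definition cf_norm x := if cf_le 0 x then x else - x.

Lemma cf_normN x : cf_norm (- x) = cf_norm x.
Proof.
rewrite /cf_norm opprK.
have E : cf_le 0 (- x) = cf_le x 0 by rewrite -[- x]sub0r cf_sub_ge0.
rewrite E; have := cf_le0_total x; have := @cf_le0_anti x.
by case: ifP; case: ifP => // _ _ ->; rewrite ?oppr0.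
Qed.

Lemma cf_ge0_norm x : cf_le 0 x -> cf_norm x = x.
Proof. by rewrite /cf_norm => ->. Qed.

HB.instance Definition _ := Num.IntegralDomain_isLeReal.Build cone_field
  cf_le0D cf_le0M cf_le0_anti cf_sub_ge0 cf_le0_total cf_normN cf_ge0_norm
  (fun _ _ => erefl).

Lemma cf_ge0 (x : cone_field) : (0 <= x) = `[< P (val x) >].
Proof. exact: cf_le0E. Qed.

End ConeField.

(** * A maximal cone gives a real closed field *)

Section RealClosed.
Variables (K : closedFieldType) (P : field_cone K).
Hypothesis Pmax : forall P' : set K, order_cone P' -> P `<=` P' -> P' `<=` P.
Notation F := (cone_field P).

(** Evaluation at the point [y] of [cone_root] has the support of [T] as kernel, so it carries [T]
    to an order cone of [K]. This cone contains [P], and [y] or [- y]; by maximality [y] already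
    lies in [F]. *)
Lemma cf_sign_change_root (q : {poly F}) a b : q.[a] * q.[b] < 0 -> exists y, root q y.
Proof.
move=> qab; have q0 : q != 0 by apply: contraTneq qab => ->; rewrite !horner0 mul0r ltxx.
have [T [PT Tc [Tq nTq] nT [tot prm]]] := sign_change_cone qab.
pose j : {rmorphism F -> K} := (val : F -> K).
have [y hy] := cone_root j PT nT tot prm Tq nTq q0.
pose ev (g : {poly F}) := (map_poly j g).[y].
have evD g h : ev (g + h) = ev g + ev h by rewrite /ev rmorphD hornerD.
have evN g : ev (- g) = - ev g by rewrite /ev rmorphN hornerN.
have evM g h : ev (g * h) = ev g * ev h by rewrite /ev rmorphM hornerM.
have evC c : ev c%:P = val c by rewrite /ev map_polyC hornerC.
pose P' : set K := [set x | exists2 g, T g & ev g = x].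
have sub : P' `<=` P.
  apply: Pmax => [|x Px]; last first.
    have xP : x \in fc_pred P by apply/asboolP; left.
    exists (ConeField xP)%:P; last by rewrite evC.
    by apply: Tc; rewrite cf_ge0; apply/asboolP.
  split.
  - by move=> _ _ [g Tg <-] [h Th <-]; exists (g + h); [exact: preconeD|].
  - by move=> _ _ [g Tg <-] [h Th <-]; exists (g * h); [exact: preconeM|].
  - by exists 1; [exact: precone1|rewrite /ev rmorph1 hornerC].
  - move=> _ [g Tg <-] [h Th E].
    have [_ Tgh] : T (g + h) /\ T (- (g + h)) by apply/hy; rewrite -/(ev _) evD E subrr.
    apply/(hy g); split=> //; have -> : - g = h + (- (g + h)) by ring.
    exact: preconeD.
  - move=> _ _ [g Tg <-] [h Th <-]; have [E|E] := tot (g - h); [left|right].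
      by exists (g - h); rewrite ?evD ?evN.
    by exists (- (g - h)); rewrite // opprB evD evN.
have yP : y \in fc_pred P.
  have evX : ev 'X = y by rewrite /ev map_polyX hornerX.
  apply/asboolP; have [TX|TX] := tot 'X; [left|right]; apply: sub.
    by exists 'X.
  by exists (- 'X); rewrite ?evN ?evX.
exists (ConeField yP); rewrite -(fmorph_root j).
by apply/rootP/hy.
Qed.

(** The root given by a sign change may lie outside the interval. The linear factor then has
    constant sign on it and is divided out, by induction on the size; when the root lies beyond [b]
    that sign is negative and [- u] takes over. *)
Lemma cf_poly_ivt : Num.real_closed_axiom F.
Proof.
move=> p; have [n] := ubnP (size p); elim: n => // n ih in p *.
move=> sp a b ab /andP[pa pb].
have [/eqP pa0|pa0] := boolP (p.[a] == 0); first by exists a; rewrite ?lexx //;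
  apply/rootP.
have [/eqP pb0|pb0] := boolP (p.[b] == 0); first by exists b; rewrite ?lexx ?ab //;
  apply/rootP.
have {}pa : p.[a] < 0 by rewrite lt_neqAle pa0.
have {}pb : 0 < p.[b] by rewrite lt_def pb0.
have [|y ry] := @cf_sign_change_root p a b; first by rewrite pmulr_llt0.
have [u pu] := factor_theorem p y ry.
have su : (size u < n)%N.
  have u0 : u != 0 by apply: contraTneq pa => u0; rewrite pu u0 mul0r horner0 ltxx.
  by move: sp; rewrite pu size_Mmonic ?monicXsubC // size_XsubC addn2.
move: pa pb; rewrite pu !hornerM !hornerXsubC.
have [ya|ay] := ltP y a.
  have yb := lt_le_trans ya ab.
  rewrite pmulr_llt0 ?subr_gt0 // pmulr_lgt0 ?subr_gt0 // => ua ub.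
  have [|x xab rx] := ih u su a b ab; first by rewrite !ltW.
  by exists x; rewrite // rootM rx.
have [yb|yb] := leP y b; first by move=> _ _; exists y;
  rewrite ?ay ?yb // rootM root_XsubC eqxx orbT.
have ya := le_lt_trans ab yb.
rewrite nmulr_llt0 ?subr_lt0 // nmulr_lgt0 ?subr_lt0 // => ua ub.
have [||x xab rx] := ih (- u) _ a b ab; first by rewrite size_polyN.
  by rewrite !hornerN oppr_le0 oppr_ge0 !ltW.
by exists x; rewrite // rootM -rootN rx.
Qed.

Definition cone_rcf : rcfType :=
  HB.pack_for rcfType F (Num.RealField_isClosed.Build F cf_poly_ivt).

End RealClosed.

(** The image of [T] under [g] orders the image of [A]; a maximal cone above it supplies [S], and
    [g] itself, read in [S], is the morphism. *)
Lemma prime_cone_rcf (A : comNzRingType) (K : closedFieldType) (g : {rmorphism A -> K})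
    (T : set A) :
  precone T -> (forall a, T a \/ T (- a)) ->
  (forall a, g a = 0 <-> T a /\ T (- a)) ->
  exists (S : rcfType) (f : {rmorphism A -> S}), forall a, 0 <= f a <-> T a.
Proof.
move=> PT tot ker.
have hP0 : order_cone [set x | exists2 a, T a & g a = x].
  split.
  - by move=> _ _ [a Ta <-] [b Tb <-]; exists (a + b); [exact: preconeD|rewrite rmorphD].
  - by move=> _ _ [a Ta <-] [b Tb <-]; exists (a * b); [exact: preconeM|rewrite rmorphM].
  - by exists 1; [exact: precone1|rewrite rmorph1].
  - move=> _ [a Ta <-] [b Tb E].
    have [_ Tab] : T (a + b) /\ T (- (a + b)) by apply/ker; rewrite rmorphD E subrr.
    apply/ker; split=> //; have -> : - a = b + (- (a + b)) by ring.
    exact: preconeD.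
  - move=> _ _ [a Ta <-] [b Tb <-]; have [E|E] := tot (a - b); [left|right].
      by exists (a - b); rewrite ?rmorphB.
    by exists (- (a - b)); rewrite // opprB rmorphB.
have [M [hM P0M Mmax]] := order_cone_maximal hP0.
have MV x : M x -> M x^-1.
  move=> Mx; have [->|x0] := eqVneq x 0; first by rewrite invr0; exact: order_cone0.
  apply: (Mmax _ (order_cone_fractions hM)) => [y My|].
    by exists y, 1; rewrite divr1 oner_eq0; split=> //; exact: order_cone1.
  by exists 1, x; rewrite div1r; split=> //; exact: order_cone1.
pose P := FieldCone hM MV.
have gP a : g a \in fc_pred P.
  apply/asboolP; have [Ta|Ta] := tot a; [left|right]; apply: P0M; first by exists a.
  by exists (- a); rewrite ?rmorphN.
pose S := @cone_rcf K P Mmax; pose v : {rmorphism cone_field P ->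
  K} := (val : cone_field P -> K).
pose f a : S := ConeField (gP a).
have fB : zmod_morphism f.
  by move=> a b; apply: val_inj; rewrite [RHS](rmorphB v) /= rmorphB.
have fM : monoid_morphism f.
  split; first by apply: val_inj; rewrite [RHS](rmorph1 v) /= rmorph1.
  by move=> a b; apply: val_inj; rewrite [RHS](rmorphM v) /= rmorphM.
pose fr := HB.pack_for {rmorphism A -> S} f
  (GRing.isZmodMorphism.Build A S f fB) (GRing.isMonoidMorphism.Build A S f fM).
exists S, fr => a; rewrite -[0 <= fr a]/(0 <= (f a : cone_field P)) cf_ge0.
split=> [/asboolP/= Mga|Ta]; last by apply/asboolP; apply: P0M; exists a.
(* If [- a] is in [T], then [g a] and its opposite are both in [M], so [g a = 0] and [a] is in the
   support. *)
have [//|Ta] := tot a.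
have /ker[] // : g a = 0.
apply: (order_cone_anti hM) => //; apply: P0M; exists (- a) => //.
by rewrite rmorphN.
Qed.

(** * Points of countable rings *)

(** Inverses are chosen classically on the same carrier; [g] is the identity back to [A], by which
    an injection into [nat] is transported. *)
Lemma com_unit_ring (A : comNzRingType) (dom : GRing.integral_domain_axiom A) :
  exists (D : idomainType) (f : {rmorphism A -> D}) (g : D -> A),
    cancel g f /\ injective f.
Proof.
pose inv (x : A) := if pselect (exists y, y * x = 1) is left h then sval (cid h) else x.
pose unit : {pred A} := fun x => `[< exists y, y * x = 1 >].
have mulV : {in unit, left_inverse 1 inv *%R}.
  move=> x /asboolP xu; rewrite /inv; case: pselect => // h.
  by case: cid.
have unitPl (x y : A) : y * x = 1 -> unit x by move=> yx; apply/asboolP; exists y.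
have invo : {in [predC unit], inv =1 id}.
  move=> x /asboolPn xu; rewrite /inv; case: pselect => //.
pose D := HB.pack_for comUnitRingType A (GRing.ComNzRing_hasMulInverse.Build A mulV unitPl invo).
pose D' := HB.pack_for idomainType D (GRing.ComUnitRing_isIntegral.Build D dom).
by exists D', (@idfun A : {rmorphism A -> A}), id; split.
Qed.

Lemma countable_field_of_domain (A : idomainType) (c : A -> nat) : injective c ->
  exists (K : countFieldType) (g : {rmorphism A -> K}), injective g.
Proof.
move=> cinj.
pose code (x : {fraction A}) := (c (val (repr x)).1, c (val (repr x)).2).
have codeK : injective (pickle \o code).
  move=> x y /(pcan_inj pickleK)[/cinj e1 /cinj e2].
  rewrite -[x]reprK -[y]reprK; congr (\pi _); apply: val_inj.
  by rewrite [LHS]surjective_pairing [RHS]surjective_pairing e1 e2.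
have dec : exists d : nat -> option {fraction A}, pcancel (pickle \o code) d.
  exists (fun n => if pselect (exists x, (pickle \o code) x = n) is left h
                   then Some (sval (cid h)) else None) => x.
  case: pselect => [h|[]]; last by exists x.
  by case: cid => y /= /codeK ->.
have [d dK] := dec.
pose K := HB.pack_for countFieldType {fraction A}
  (Choice_isCountable.Build {fraction A} dK).
exists K, (@tofrac A : {rmorphism A -> {fraction A}}) => x y /eqP.
by rewrite tofrac_eq => /eqP.
Qed.

(* The injection [c] into [nat] is there because [countable_algebraic_closure]
   only covers countable fields. *)
Lemma prime_ideal_closed_field (A : comNzRingType) (I : set A) (c : A -> nat) :
  injective c -> I 0 -> ~ I 1 ->
  (forall a x y, I x -> I y -> I (a * x + y)) ->
  (forall x y, I (x * y) -> I x \/ I y) ->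
  exists (K : closedFieldType) (g : {rmorphism A -> K}), forall a, g a = 0 <-> I a.
Proof.
move=> cinj I0 I1 IM Ip.
pose S : pred A := fun a => `[< I a >].
have Sc : idealr_closed S.
  split; [exact/asboolP|exact/asboolPn|].
  by move=> a x y /asboolP ? /asboolP ?; apply/asboolP; exact: IM.
have Sp : prime_idealr_closed S.
  by move=> x y /asboolP /Ip [] h; apply/orP; [left|right]; exact/asboolP.
pose J := HB.pack_for (prime_idealr A) S (isIdealr.Build A S Sc)
  (isPrimeIdealrClosed.Build A S Sp).
have [D [f [g [gK finj]]]] :=
  @com_unit_ring {ideal_quot J} (@Quotient.rquot_IdomainAxiom A J).
have cinj' : injective (fun x : D => c (repr (g x))).
  by move=> x y /cinj e; rewrite -[x]gK -[y]gK -[g x]reprK -[g y]reprK e.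
have [L [h hinj]] := countable_field_of_domain cinj'.
have [K [k _]] := countable_algebraic_closure L.
exists K, (k \o h \o f \o \pi_{ideal_quot J}) => a /=.
split=> [/eqP|Ia].
  rewrite fmorph_eq0 -(rmorph0 h) => /eqP /hinj; rewrite -(rmorph0 f) => /finj e.
  have : a - 0 \in J by rewrite Quotient.idealrBE e; apply/eqP;
    rewrite (rmorph0 (\pi_{ideal_quot J} : {rmorphism A -> {ideal_quot J}})).
  by rewrite subr0 => /asboolP.
have -> : \pi_{ideal_quot J} a = 0 :> {ideal_quot J}.
  rewrite -(rmorph0 (\pi_{ideal_quot J} : {rmorphism A -> {ideal_quot J}})).
  by apply/eqP; rewrite -Quotient.idealrBE subr0; exact/asboolP.
by rewrite !rmorph0.
Qed.

Lemma precone_rcf (A : comNzRingType) (c : A -> nat) (T : set A) s :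
  injective c -> precone T -> T s -> (forall k, ~ T (- s ^+ k)) ->
  exists (S : rcfType) (f : {rmorphism A -> S}),
    (forall a, T a -> 0 <= f a) /\ 0 < f s.
Proof.
move=> cinj PT Ts nT.
have [T' [PT' TT' nT' tot prm]] := prime_cone PT Ts nT.
have T's := TT' _ Ts.
have nT's : ~ T' (- s) by rewrite -[s]expr1; exact: nT'.
have nT'1 : ~ T' (- 1) by move=> h; apply: nT's; rewrite -mulN1r; exact: preconeM.
have T0 := precone0 PT'.
have [||a x y|x y|K [g ker]] :=
  @prime_ideal_closed_field A (fun a => T' a /\ T' (- a)) c cinj.
- by rewrite oppr0; split.
- by case.
- move=> [Tx nTx] [Ty nTy]; split.
    by apply: preconeD => //; rewrite mulrC; exact: precone_support.
  by rewrite opprD; apply: preconeD => //; rewrite mulrC -mulNr;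
    apply: precone_support => //; rewrite opprK.
- by case; exact: prm.
have [S [f hf]] := prime_cone_rcf PT' tot ker.
exists S, f; split=> [a Ta|]; first by apply/hf; exact: TT'.
by rewrite ltNge -oppr_ge0 -rmorphN; apply/negP => /hf.
Qed.

(** * Positive functionals *)

Section PositiveFunctional.
Variables (K : numClosedFieldType) (B : comAlgType K) (star : B -> B).
Hypotheses (starD : forall p q, star (p + q) = star p + star q)
  (starM : forall p q, star (p * q) = star p * star q)
  (starZ : forall c p, star (c *: p) = c^* *: star p)
  (starK : involutive star).
Variable L : {scalar B}.
Hypothesis L_ge0 : forall p, 0 <= L (star p * p).
Implicit Types p q u : B.

(** Since [star] is onto, this is the radical of the form sending [p] and [u] to
    [L (star u * p)]. *)
Definition null_elt p := forall u, L (u * p) = 0.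

(** In [L (star (p + c *: u) * (p + c *: u))] the constant term is zero, so the part linear in [c]
    must vanish: otherwise it would outweigh the quadratic part for small [c]. *)
Lemma null_elt_cs p : L (star p * p) = 0 -> null_elt p.
Proof.
move=> Lp u0; rewrite -[u0]starK; move: (star u0) => {u0} u.
set a := L (star u * p); set b := L (star p * u); set D := L (star u * u).
have key (c : K) : 0 <= c * b + c^* * a + c^* * c * D.
  have := L_ge0 (p + c *: u); rewrite starD starZ.
  rewrite mulrDl !mulrDr -!scalerAl -!scalerAr !linearD !linearZ /= Lp -/a -/b -/D.
  by rewrite add0r addrA mulrA.
have D0 : 0 <= D by exact: L_ge0.
(* In place of a limit as [t] tends to 0, the choice [t = y / (D + y)] turns the bound into
   [0 <= - (y ^+ 2 / (D + y))]. *)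
have small (x : K) : (forall t, 0 < t -> 0 <= x + t * D) ->
    (forall t, 0 < t -> 0 <= - x + t * D) -> x = 0.
  have aux (y : K) : (forall t, 0 < t -> 0 <= - y + t * D) -> ~~ (0 < y).
    move=> h; apply/negP => y0; have yD : 0 < D + y by rewrite ltr_wpDl.
    have := h (y / (D + y)) (divr_gt0 y0 yD).
    have -> : - y + y / (D + y) * D = - (y ^+ 2 / (D + y)) by field; rewrite gt_eqF.
    by rewrite oppr_ge0 lt_geF // divr_gt0 // exprn_gt0.
  move=> hp hm; have xR : x \is Num.real.
    have -> : x = (x + 1 * D) - D by ring.
    by rewrite rpredB // realE ?hp ?D0.
  case: (real_ltgt0P xR) => // x0; first by have := aux x hm; rewrite x0.
  by have := aux (- x); rewrite opprK oppr_gt0 x0 => /(_ hp).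
have step (d : K) : d^* * d = 1 -> d * b + d^* * a = 0.
  move=> dd; have keyt (t : K) : t \is Num.real ->
    0 <= t * (d * b + d^* * a) + t ^+ 2 * D.
    move=> tR; have := key (t * d); rewrite rmorphM /= (CrealP tR).
    have -> : t * d^* * (t * d) * D = t ^+ 2 * (d^* * d) * D by ring.
    by rewrite dd mulr1; congr (0 <= _); ring.
  apply: small => t t0; rewrite -(pmulr_rge0 _ t0).
    by have := keyt t (gtr0_real t0); congr (0 <= _); ring.
  have := keyt (- t); rewrite rpredN => /(_ (gtr0_real t0)).
  by congr (0 <= _); ring.
(* As [a] and [b] are not known to be conjugate, two directions are used: [d = 1] gives [a = - b]
   and [d = 'i] gives [a = b]. *)
have /eqP := step 1 (ltac:(by rewrite rmorph1 mulr1)).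
rewrite rmorph1 !mul1r addrC addr_eq0 => /eqP ab.
have := step 'i (ltac:(by rewrite conjCi mulNr -expr2 sqrCi opprK)).
rewrite conjCi ab => /eqP; have -> : 'i * b + - 'i * - b = 'i * b *+ 2 by ring.
by rewrite mulrn_eq0 /= mulf_eq0 (negbTE (neq0Ci K)) /= => /eqP ->; rewrite oppr0.
Qed.

Lemma null_eltD p q : null_elt p -> null_elt q -> null_elt (p + q).
Proof. by move=> hp hq u; rewrite mulrDr linearD /= hp hq addr0. Qed.

Lemma null_eltM p q : null_elt p -> null_elt (p * q).
Proof. by move=> hp u; rewrite mulrCA mulrC. Qed.

Lemma null_eltN p : null_elt p -> null_elt (- p).
Proof. by move=> hp; rewrite -mulrN1; exact: null_eltM. Qed.

Lemma null_elt_star p : null_elt p -> null_elt (star p).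
Proof. by move=> hp; apply: null_elt_cs; rewrite starK mulrC hp. Qed.

Lemma star1 : star 1 = 1.
Proof. by have := starM (star 1) 1; rewrite mulr1 starK mul1r => <-. Qed.

Lemma starX p k : star (p ^+ k) = star p ^+ k.
Proof.
elim: k => [|k ih]; first by rewrite !expr0 star1.
by rewrite !exprS starM ih.
Qed.

(** The exponent drops by one through [star p * p ^+ k.+1]: its hermitian square is that of
    [p ^+ k.+2], so it is null, and it divides the hermitian square of [p ^+ k.+1]. *)
Lemma null_elt_exp p k : null_elt (p ^+ k) -> null_elt p.
Proof.
elim: k => [|k ih].
  by rewrite expr0 => h; rewrite -[p]mul1r; exact: null_eltM.
case: k ih => [|k] ih; first by rewrite expr1.
move=> h; apply: ih; apply: null_elt_cs.
have hw : null_elt (star p * p ^+ k.+1).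
  apply: null_elt_cs; rewrite starM starK starX.
  have -> : p * star p ^+ k.+1 * (star p * p ^+ k.+1) = star p ^+ k.+2 * p ^+ k.+2.
    by rewrite !exprS; ring.
  exact: h.
have -> : star (p ^+ k.+1) * p ^+ k.+1 = star p ^+ k * (star p * p ^+ k.+1).
  by rewrite starX exprS; ring.
exact: hw.
Qed.

Definition hermitian_squares (rs : seq B) := \sum_(r <- rs) star r * r.

Definition sos_mod_null p := exists rs, null_elt (p - hermitian_squares rs).

Lemma sos_mod_null_null p : null_elt p -> sos_mod_null p.
Proof. by move=> hp; exists [::]; rewrite /hermitian_squares big_nil subr0. Qed.

Lemma sos_mod_null_square r : sos_mod_null (star r * r).
Proof.
exists [:: r]; rewrite /hermitian_squares big_seq1 subrr => u.
by rewrite mulr0 linear0.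
Qed.

Lemma sos_mod_nullD p q : sos_mod_null p -> sos_mod_null q -> sos_mod_null (p + q).
Proof.
move=> [rs hr] [ts ht]; exists (rs ++ ts); rewrite /hermitian_squares big_cat /=.
by rewrite opprD addrACA; exact: null_eltD.
Qed.

Lemma sos_mod_nullM p q : sos_mod_null p -> sos_mod_null q -> sos_mod_null (p * q).
Proof.
move=> [rs hr] [ts ht]; exists [seq r * t | r <- rs, t <- ts].
have -> : hermitian_squares [seq r * t | r <- rs, t <- ts] =
    hermitian_squares rs * hermitian_squares ts.
  rewrite /hermitian_squares big_allpairs_dep /= big_distrl /=; apply: eq_bigr => r _.
  by rewrite big_distrr /=; apply: eq_bigr => t _; rewrite starM mulrACA.
set x := hermitian_squares rs in hr *; set y := hermitian_squares ts in ht *.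
have -> : p * q - x * y = (p - x) * q + (q - y) * x by ring.
by apply: null_eltD; exact: null_eltM.
Qed.

(** Applying [L] gives two nonnegative numbers with sum zero, one of them the value at the hermitian
    square of [p ^+ k]. *)
Lemma sos_mod_nullN_exp p k : sos_mod_null (- (star p * p) ^+ k) -> null_elt p.
Proof.
move=> [rs h]; apply: (@null_elt_exp _ k); apply: null_elt_cs.
have /eqP := h 1; rewrite mul1r linearB /= linearN /= -opprD oppr_eq0.
have Lr : 0 <= L (hermitian_squares rs).
  rewrite /hermitian_squares linear_sum; apply: sumr_ge0 => r _; exact: L_ge0.
by rewrite exprMn -starX (paddr_eq0 (L_ge0 _) Lr) => /andP[/eqP].
Qed.

(** As [phi] takes hermitian values, squares of [A] become hermitian squares, and the elements that
    [phi] sends to sums of these modulo null elements form a precone. *)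
Lemma null_elt_or_rcf (A : comNzRingType) (c : A -> nat) (phi : {rmorphism A -> B}) s p :
  injective c -> (forall a, star (phi a) = phi a) -> phi s = star p * p ->
  ~ null_elt p ->
  exists (S : rcfType) (f : {rmorphism A -> S}),
    (forall a, sos_mod_null (phi a) -> 0 <= f a) /\ 0 < f s.
Proof.
move=> cinj herm phis np.
apply: (@precone_rcf A c [set a | sos_mod_null (phi a)] s) => //.
- split=> [a b|a b|a] /=.
  + by rewrite rmorphD; exact: sos_mod_nullD.
  + by rewrite rmorphM; exact: sos_mod_nullM.
  + by rewrite rmorphXn expr2 -{1}herm; exact: sos_mod_null_square.
- by rewrite /= phis; exact: sos_mod_null_square.
- by move=> k /=; rewrite rmorphN rmorphXn phis => /sos_mod_nullN_exp.
Qed.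

End PositiveFunctional.

(** * Specialization of parameters *)

Section TermEval.

(** One rational term is evaluated in the parameter ring, in [cpoly R n], in [S] and in [R]; [h]
    interprets its constants in each. *)
Fixpoint teval (B : comNzRingType) (h : rat -> B) (e : seq B) (t : term rat) : B :=
  match t with
  | Var i => e`_i
  | Const c => h c
  | NatConst n => n%:R
  | Add u v => teval h e u + teval h e v
  | Opp u => - teval h e u
  | NatMul u n => teval h e u *+ n
  | Mul u v => teval h e u * teval h e v
  | Exp u n => teval h e u ^+ n
  end.

Lemma rat_eval_teval (S : realFieldType) (e : seq S) t :
  rat_eval e t = teval (@ratr S) e t.
Proof.
by rewrite /rat_eval; elim: t => //= [u -> v ->|u ->|u -> n|u -> v ->|u -> n].
Qed.

Lemma rmorph_teval (B B' : comNzRingType) (f : {rmorphism B -> B'}) h h' e t :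
  f \o h =1 h' -> f (teval h e t) = teval h' (map f e) t.
Proof.
move=> fh; elim: t => /= [i|q|n|u <- v <-|u <-|u <- n|u <- v <-|u <- n].
- have [lt|le] := ltnP i (size e); first by rewrite (nth_map 0).
  by rewrite !nth_default ?size_map // rmorph0.
- exact: fh.
- exact: rmorph_nat.
- exact: rmorphD.
- exact: rmorphN.
- exact: rmorphMn.
- exact: rmorphM.
- exact: rmorphXn.
Qed.

Lemma eq_teval (B : comNzRingType) (h h' : rat -> B) e e' t :
  h =1 h' -> (forall i, e`_i = e'`_i) -> teval h e t = teval h' e' t.
Proof.
move=> hh ee.
by elim: t => //= [u -> v ->|u ->|u -> n|u -> v ->|u -> n].
Qed.

End TermEval.

Definition poly_vars m : seq (mpoly m rat) := [seq mpolyX rat (mnm1 i) | i <- enum 'I_m].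

Lemma mpoly_rat_countable m : exists c : mpoly m rat -> nat, injective c.
Proof.
exists (fun p => pickle [seq (mm, mcoeff mm p) | mm <- msupp p]) => p q.
move=> /(pcan_inj pickleK) e; rewrite [p]mpolyE [q]mpolyE.
transitivity (\sum_(x <- [seq (mm, mcoeff mm p) | mm <- msupp p]) x.2 *: mpolyX rat x.1).
  by rewrite [RHS]big_map.
by rewrite e [LHS]big_map.
Qed.

Section Specialization.
Variables (R : rcfType) (B : comNzRingType) (con : {rmorphism R ->
  B}) (xs : seq B) (cs : seq R).
Let m := (size xs + size cs)%N.
Let env := xs ++ map con cs.

(** Variables become first the coordinates [xs], then the actual real parameters [cs]. Along this
    morphism [L] is pulled back to a countable ring. *)
Definition spec : mpoly m rat -> B :=
  mmap (con \o @ratr R) (fun i : 'I_m => env`_i).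
HB.instance Definition _ := GRing.RMorphism.on spec.

Lemma spec_const q : spec (mpolyC m q) = con (ratr q).
Proof. by rewrite /spec mmapC. Qed.

Lemma spec_vars : map spec (poly_vars m) = env.
Proof.
rewrite /poly_vars -map_comp; apply: (@eq_from_nth _ 0).
  by rewrite size_map size_enum_ord size_cat size_map.
move=> i; rewrite size_map size_enum_ord => im.
rewrite (nth_map (Ordinal im)) ?size_enum_ord //= /spec mmapX mmap1U.
by rewrite nth_enum_ord.
Qed.

Lemma spec_teval t : spec (teval (@mpolyC m rat) (poly_vars m) t) =
  teval (con \o @ratr R) env t.
Proof. by rewrite (rmorph_teval _ _ (h' := con \o @ratr R)) ?spec_vars //;
  exact: spec_const. Qed.

End Specialization.
Arguments spec {R B} con xs cs p.
Arguments spec_const {R B} con xs cs q.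

(** * Real and imaginary parts as rational terms in real parameters *)

Section Representation.
Variables (R : rcfType) (B : comNzRingType) (con : {rmorphism R ->
  B}) (I : B) (xs : seq B).
Hypothesis I2 : I ^+ 2 = - 1.

Definition param_eval (cs : seq R) (t : term rat) : B :=
  teval (con \o @ratr R) (xs ++ map con cs) t.

(* The real and imaginary parts of [p] are rational polynomials in [xs] and in
   real parameters appended to [c0]; quantifying over [c0] and over further
   parameters [c2] lets several elements share one list of parameters. *)
Definition param_split (p : B) := forall c0, exists c1 t1 t2, forall c2,
  p = param_eval (c0 ++ c1 ++ c2) t1 + I * param_eval (c0 ++ c1 ++ c2) t2.

Lemma param_splitD p q : param_split p -> param_split q -> param_split (p + q).
Proof.
move=> hp hq c0; have [c1 [t1 [t2 E]]] := hp c0; have [c1' [u1 [u2 E']]] := hq (c0 ++ c1).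
exists (c1 ++ c1'), (Add t1 u1), (Add t2 u2) => c2;
  rewrite /param_eval /= -!/(param_eval _ _).
have := E (c1' ++ c2); have := E' c2; rewrite -!catA => {1}-> {1}->.
by ring.
Qed.

Lemma param_splitM p q : param_split p -> param_split q -> param_split (p * q).
Proof.
move=> hp hq c0; have [c1 [t1 [t2 E]]] := hp c0; have [c1' [u1 [u2 E']]] := hq (c0 ++ c1).
exists (c1 ++ c1'), (Add (Mul t1 u1) (Opp (Mul t2 u2))), (Add (Mul t1 u2)
  (Mul t2 u1)) => c2.
rewrite /param_eval /= -!/(param_eval _ _).
have := E (c1' ++ c2); have := E' c2; rewrite -!catA => {1}-> {1}->.
set a := param_eval _ _; set b := param_eval _ _; set a' := param_eval _ _;
  set b' := param_eval _ _.
have -> : (a + I * b) * (a' + I * b') =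
  a * a' + I ^+ 2 * (b * b') + I * (a * b' + b * a') by ring.
by rewrite I2; ring.
Qed.

Lemma param_split_con x : param_split (con x).
Proof.
move=> c0; exists [:: x], (Var _ (size xs + size c0)), (NatConst _ 0) => c2.
rewrite /param_eval /= mulr0 addr0 nth_cat ltnNge leq_addr /= addKn.
by rewrite map_cat nth_cat size_map ltnn subnn.
Qed.

Lemma param_split_var i : (i < size xs)%N -> param_split xs`_i.
Proof.
move=> lt c0; exists [::], (Var _ i), (NatConst _ 0) => c2.
by rewrite /param_eval /= mulr0 addr0 nth_cat lt.
Qed.

Lemma param_split_I : param_split I.
Proof.
move=> c0; exists [::], (NatConst _ 0), (NatConst _ 1) => c2.
by rewrite /param_eval /= mulr1 add0r.
Qed.

Lemma param_splitX p k : param_split p -> param_split (p ^+ k).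
Proof.
move=> hp; elim: k => [|k ih]; first by rewrite expr0 -(rmorph1 con);
  exact: param_split_con.
by rewrite exprS; exact: param_splitM.
Qed.

End Representation.

(** * A real point from a null and a non-null element *)

Section RealPoint.
Variables (R : realType) (K : numClosedFieldType) (B : comAlgType K) (star : B -> B).
Hypotheses (starD : forall p q, star (p + q) = star p + star q)
  (starM : forall p q, star (p * q) = star p * star q)
  (starZ : forall c p, star (c *: p) = c^* *: star p)
  (starK : involutive star).
Variable L : {scalar B}.
Hypothesis L_ge0 : forall p, 0 <= L (star p * p).
Variables (con : {rmorphism R -> B}) (I : B) (xs : seq B).
Hypotheses (star_con : forall x, star (con x) = con x) (I2 : I ^+ 2 = - 1)
  (star_I : star I = - I) (star_xs : forall i, star xs`_i = xs`_i).

Lemma star_sum (J : Type) (r : seq J) (G : J -> B) :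
  star (\sum_(j <- r) G j) = \sum_(j <- r) star (G j).
Proof.
apply: (big_morph star) => //.
by have := starZ 0 0; rewrite !scaler0 rmorph0 scale0r.
Qed.

Lemma star_spec (params : seq R) p : star (spec con xs params p) = spec con xs params p.
Proof.
rewrite /spec /mmap star_sum; apply: eq_bigr => mm _; rewrite starM star_con;
  congr (_ * _).
rewrite /mmap1 (big_morph star starM (star1 starM starK)).
apply: eq_bigr => i _; rewrite (starX starM starK); congr (_ ^+ _).
rewrite nth_cat; case: ifP => // _.
have [lt|le] := ltnP (i - size xs) (size params); first by rewrite (nth_map 0).
by rewrite nth_default ?size_map //; have := star_con 0; rewrite rmorph0.
Qed.

(** The entries of [e] below [size xs] are the coordinates being sought, the later ones the given
    parameters. Vanishing of [tq1] and [tq2] expresses [q = 0], and the positive sum of squares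
    expresses that [p] is nonzero. *)
Lemma rcf_real_point (params : seq R) p q tp1 tp2 tq1 tq2 :
  p = param_eval con xs params tp1 + I * param_eval con xs params tp2 ->
  q = param_eval con xs params tq1 + I * param_eval con xs params tq2 ->
  null_elt L q -> ~ null_elt L p ->
  exists e : seq R, (forall j, (size xs <= j)%N -> e`_j = params`_(j - size xs)) /\
    [/\ teval (@ratr R) e tq1 = 0, teval (@ratr R) e tq2 = 0 &
     0 < teval (@ratr R) e tp1 ^+ 2 + teval (@ratr R) e tp2 ^+ 2].
Proof.
set m := (size xs + size params)%N.
move=> Ep Eq Nq Np.
pose X := poly_vars m; pose tev t := teval (@mpolyC m rat) X t.
pose phi : {rmorphism mpoly m rat -> B} := spec con xs params.
have phiE t : phi (tev t) = param_eval con xs params t by exact: spec_teval.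
have star_ev t : star (param_eval con xs params t) = param_eval con xs params t.
  by rewrite -phiE star_spec.
pose ts := Add (Mul tp1 tp1) (Mul tp2 tp2).
have [c cinj] := mpoly_rat_countable m.
have phis : phi (tev ts) = star p * p.
  rewrite phiE Ep starD starM star_I !star_ev /param_eval /= -!/(param_eval _ _ _ _).
  set a := param_eval _ _ _ _; set b := param_eval _ _ _ _.
  have -> : (a + - I * b) * (a + I * b) = a * a - I ^+ 2 * (b * b) by ring.
  by rewrite I2; ring.
have [S [f [f_ge0 fs]]] := null_elt_or_rcf starD starM starZ starK L_ge0 cinj
   (@star_spec params) phis Np.
pose eS := map f X.
have ratE : f \o @mpolyC m rat =1 @ratr S by exact: (fmorph_eq_rat (f \o @mpolyC m rat)).
have evS t : rat_eval eS t = f (tev t).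
  by rewrite rat_eval_teval -(rmorph_teval _ _ ratE).
have half u : u + u = con 2 * u by rewrite rmorph_nat mulr2n mulrDl mul1r.
have con2 u : con 2^-1 * (con 2 * u) = u.
  by rewrite mulrA -rmorphM mulVf ?pnatr_eq0 // rmorph1 mul1r.
(* Null elements are stable under [star], so the real and imaginary parts of [q] are null too; they
   are recovered from [q + star q] and [(star q - q) * I] by halving. *)
have Nq' : null_elt L (star q) by exact: null_elt_star.
have N1 : null_elt L (param_eval con xs params tq1).
  rewrite -[param_eval _ _ _ _]con2 mulrC -half; apply: null_eltM.
  suff -> : param_eval con xs params tq1 + param_eval con xs params tq1 = q + star q.
    exact: null_eltD.
  by rewrite Eq starD starM star_I !star_ev; ring.
have N2 : null_elt L (param_eval con xs params tq2).
  rewrite -[param_eval _ _ _ _]con2 mulrC -half; apply: null_eltM.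
  suff -> : param_eval con xs params tq2 + param_eval con xs params tq2 =
    (star q - q) * I.
    by apply: null_eltM; apply: null_eltD => //; exact: null_eltN.
  rewrite Eq starD starM star_I !star_ev.
  set a := param_eval _ _ _ tq1; set b := param_eval _ _ _ tq2.
  have -> : (a + - I * b - (a + I * b)) * I = - I ^+ 2 * (b + b) by ring.
  by rewrite I2; ring.
have f0 t : null_elt L (param_eval con xs params t) -> f (tev t) = 0.
  move=> Nt; apply/eqP; rewrite eq_le; apply/andP; split.
    rewrite -oppr_ge0 -rmorphN; apply: f_ge0; rewrite rmorphN phiE.
    by apply: sos_mod_null_null; exact: null_eltN.
  by apply: f_ge0; rewrite phiE; exact: sos_mod_null_null.
pose F := And (Equal tq1 (NatConst _ 0)) (And (Equal tq2 (NatConst _ 0))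
  (Lt (NatConst _ 0) ts)).
have FS : rat_holds eS F.
  have := evS; rewrite /rat_holds /rat_eval /= => E.
  have := E ts; rewrite /= => ->.
  by rewrite (E tq1) (E tq2) (f0 _ N1) (f0 _ N2) eqxx fs.
(* The coordinates are quantified away, so their entries are set to zero: only the parameters have
   to be compared in sign. *)
pose d := size xs; pose e := nseq d 0 ++ drop d eS; pose e' := nseq d 0 ++ params.
have eSe j : (d <= j)%N -> eS`_j = e`_j.
  by move=> dj; rewrite /e nth_cat size_nseq ltnNge dj /= nth_drop subnKC.
(* [f] restricted to the parameters is order preserving: here [R] being
   archimedean is what excludes positive parameters from the kernel of [f]. *)
have sgn t : (0 < rat_eval e t) = (0 < rat_eval e' t).
  pose h := teval (@mpolyC m rat) (nseq d 0 ++ drop d X) t.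
  have fh : f h = rat_eval e t.
    rewrite /h (rmorph_teval _ _ ratE) rat_eval_teval map_cat map_drop map_nseq.
    by rewrite rmorph0.
  have phih : phi h = con (rat_eval e' t).
    rewrite /h (rmorph_teval _ _ (spec_const con xs params)) rat_eval_teval.
    rewrite (rmorph_teval _ _ (h' := con \o @ratr R)) //.
    rewrite !map_cat map_drop spec_vars !map_nseq !rmorph0.
    by rewrite drop_size_cat.
  (* The square root of [x] exists in [R] but not in the countable ring, so the hermitian square is
     formed in [B], from [phi g = con x]. *)
  have pos g x : 0 <= x -> phi g = con x -> 0 <= f g.
    move=> x0 gx; apply: f_ge0; rewrite gx -(sqr_sqrtr x0) rmorphXn expr2 -{1}star_con.
    exact: sos_mod_null_square.
  have [r0|r0] := ltP 0 (rat_eval e' t); last first.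
    apply/negbTE; rewrite -leNgt -oppr_ge0 -fh -rmorphN.
    by apply: (pos _ (- rat_eval e' t)); rewrite ?oppr_ge0 // !rmorphN phih.
  have [M rM] : exists M : nat, 1 <= rat_eval e' t * M%:R.
    exists (Num.bound (rat_eval e' t)^-1).
    rewrite -ler_pdivrMl // mulr1; apply: ltW.
    by apply: archi_boundP; rewrite invr_ge0 ltW.
  rewrite -fh; have : 0 <= f (h * M%:R - 1).
    apply: (pos _ (rat_eval e' t * M%:R - 1)); first by rewrite subr_ge0.
    by rewrite !rmorphB !rmorphM !rmorph_nat !rmorph1 phih.
  rewrite rmorphB rmorphM rmorph_nat rmorph1 subr_ge0 => h1.
  rewrite ltNge; apply/negP => h0.
  by have := le_trans h1 (mulr_le0_ge0 h0 (ler0n _ M)); rewrite ler10.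
have [e1 [e1e' Fe1]] := rcf_transfer sgn eSe FS.
exists e1; split=> [j dj|].
  by rewrite e1e' // /e' nth_cat size_nseq ltnNge dj.
move: Fe1; rewrite /rat_holds /=.
have E := @rat_eval_teval R e1; rewrite /rat_eval in E.
rewrite !E => /andP[/eqP -> /andP[/eqP ->]] h; split=> //.
Qed.

End RealPoint.

(** * Real coordinates *)

Section Coordinates.
Local Open Scope complex_scope.
Local Open Scope ring_scope.
Variables (R : realType) (n : nat).
#[local] Opaque cstar.

Definition cst (c : R[i]) : cpoly R n := c *: 1.
Definition rcst (x : R) : cpoly R n := x%:C *: 1.
Definition re_var (j : 'I_n) : cpoly R n := (2^-1)%:C *: (varX R j + varY R j).
(** The scalar is [1 / (2 i)], which makes this the hermitian element that evaluates to the
    imaginary part of the coordinate. *)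
Definition im_var (j : 'I_n) : cpoly R n := (0 +i* - 2^-1) *: (varX R j - varY R j).
Definition coords : seq (cpoly R n) :=
  [seq re_var j | j <- enum 'I_n] ++ [seq im_var j | j <- enum 'I_n].

Lemma rcst_zmod : zmod_morphism rcst.
Proof. by move=> x y; rewrite /rcst rmorphB scalerBl. Qed.
Lemma rcst_monoid : monoid_morphism rcst.
Proof.
split; first by rewrite /rcst rmorph1 scale1r.
by move=> x y; rewrite /rcst rmorphM -scalerAl mul1r scalerA.
Qed.
HB.instance Definition _ := GRing.isZmodMorphism.Build R (cpoly R n) rcst rcst_zmod.
HB.instance Definition _ := GRing.isMonoidMorphism.Build R (cpoly R n) rcst rcst_monoid.

Lemma cstar_rcst x : cstar (rcst x) = rcst x.
Proof. by rewrite /rcst cstarZ cstar1; congr (_ *: _); exact: conjc_real. Qed.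

Lemma conjC_im (x : R) : (0 +i* x : R[i])^* = - (0 +i* x).
Proof. by apply/eqP; rewrite eq_complex /= oppr0 !eqxx. Qed.

Lemma conjC_re (x : R) : (x%:C : R[i])^* = x%:C.
Proof. exact: conjc_real. Qed.

Lemma cstar_i : cstar (cst 'i%C) = - cst 'i%C.
Proof. by rewrite /cst cstarZ cstar1 conjC_im scaleNr. Qed.

Lemma cst_i2 : cst 'i%C ^+ 2 = - 1.
Proof. by rewrite /cst exprZn expr1n sqr_i scaleN1r. Qed.

Lemma cstar_coords i : cstar (coords`_i) = coords`_i.
Proof.
have [lt|le] := ltnP i (size coords); last by rewrite nth_default // cstar0.
have := mem_nth 0 lt; rewrite mem_cat => /orP[]/mapP[j _ ->].
  by rewrite /re_var cstarZ cstarD cstarX cstarY addrC conjC_re.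
rewrite /im_var cstarZ -[- varY R j]scaleN1r cstarD cstarZ cstarX cstarY.
by rewrite rmorphN1 !scaleN1r conjC_im -opprB scalerN scaleNr opprK.
Qed.

Lemma size_coords : size coords = (n + n)%N.
Proof. by rewrite size_cat (size_map re_var) (size_map im_var) size_enum_ord. Qed.

Lemma coords_re (j : 'I_n) : coords`_j = re_var j.
Proof.
rewrite nth_cat size_map size_enum_ord ltn_ord (nth_map j) ?size_enum_ord //.
by rewrite nth_ord_enum.
Qed.

Lemma coords_im (j : 'I_n) : coords`_(n + j) = im_var j.
Proof.
rewrite nth_cat size_map size_enum_ord ltnNge leq_addr /= addKn.
by rewrite (nth_map j) ?size_enum_ord // nth_ord_enum.
Qed.

Lemma varX_coords (j : 'I_n) : varX R j = re_var j + cst 'i%C * im_var j.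
Proof.
rewrite /re_var /im_var /cst -scalerAl mul1r scalerA.
have -> : 'i%C * (0 +i* - 2^-1) = (2^-1)%:C :> R[i].
  by apply/eqP; rewrite eq_complex /= !(mul0r, mulr0, mul1r, opprK, addr0, sub0r) !eqxx.
rewrite -scalerDr addrACA subrr addr0 -mulr2n -[varX R j *+ 2]scaler_nat scalerA.
have -> : (2^-1)%:C * 2 = 1 :> R[i].
  by rewrite -(rmorph_nat (@real_complex R)) -rmorphM mulVf ?pnatr_eq0 // rmorph1.
by rewrite scale1r.
Qed.

Lemma varY_coords (j : 'I_n) : varY R j = re_var j + rcst (-1) * (cst 'i%C * im_var j).
Proof.
have := cstarX R j; rewrite varX_coords cstarD cstarM cstar_i.
rewrite -coords_re -coords_im !cstar_coords => <-.
by rewrite rmorphN1 mulN1r mulNr.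
Qed.

Lemma cpoly_param_split (p : cpoly R n) : param_split rcst (cst 'i%C) coords p.
Proof.
pose con : {rmorphism R -> cpoly R n} := rcst.
have D := @param_splitD _ _ con (cst 'i%C) coords.
have M := @param_splitM _ _ con _ coords cst_i2.
have C := @param_split_con _ _ con (cst 'i%C) coords.
have I := @param_split_I _ _ con (cst 'i%C) coords.
have V i : (i < n + n)%N -> param_split rcst (cst 'i%C) coords coords`_i.
  by move=> h; apply: param_split_var; rewrite size_coords.
have Z (c : R[i]) : param_split rcst (cst 'i%C) coords (cst c).
  have -> : cst c = rcst (complex.Re c) + cst 'i%C * rcst (complex.Im c).
    by rewrite /cst /rcst -scalerAl mul1r scalerA -scalerDl -complexE.
  by apply: D => //; exact: M.
have Re (j : 'I_n) : param_split rcst (cst 'i%C) coords (re_var j).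
  by rewrite -coords_re; apply: V; rewrite ltn_addr.
have Im (j : 'I_n) : param_split rcst (cst 'i%C) coords (im_var j).
  by rewrite -coords_im; apply: V; rewrite ltn_add2l.
have X k : param_split rcst (cst 'i%C) coords (mpolyX R[i] (mnm1 k)).
  rewrite -[k]splitK; case: (fintype.split k) => j /=.
    rewrite -/(varX R j) varX_coords; apply: D => //; exact: M.
  rewrite -/(varY R j) varY_coords; apply: D => //; apply: (M) => //; exact: M.
elim/mpolyind: p => [|c m p _ _ ih].
  by rewrite -(rmorph0 con).
apply: (D) => //; rewrite -[mpolyX _ _]mul1r scalerAl; apply: (M); first exact: Z.
rewrite mpolyXE_id; elim/big_ind: _ => [|p1 p2|k _].
- by rewrite -(rmorph1 con).
- exact: M.
- by apply: (@param_splitX _ _ con _ coords cst_i2); exact: X.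
Qed.

End Coordinates.

(** * Evaluation at points with prescribed real coordinates *)

Section Evaluation.
Local Open Scope complex_scope.
Local Open Scope ring_scope.
Variables (R : realType) (n : nat).

Definition ceval_at (z : cspace R n) : {rmorphism cpoly R n -> R[i]} :=
  meval (fun k => match fintype.split k return R[i] with
                  | inl j => z 0 j
                  | inr j => (z 0 j : R[i])^*
                  end).

Lemma ceval_atE z p : ceval p z = ceval_at z p.
Proof. by []. Qed.

Lemma ceval_varX z (j : 'I_n) : ceval_at z (varX R j) = z 0 j.
Proof.
rewrite -ceval_atE /ceval /varX mevalXU; case: fintype.split_ordP => k.
  by move/lshift_inj ->.
by move/eqP; rewrite eq_lrshift.
Qed.

Lemma ceval_varY z (j : 'I_n) : ceval_at z (varY R j) = (z 0 j : R[i])^*.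
Proof.
rewrite -ceval_atE /ceval /varY mevalXU; case: fintype.split_ordP => k.
  by move/eqP; rewrite eq_rlshift.
by move/rshift_inj ->.
Qed.

Lemma ceval_scale z c p : ceval_at z (c *: p) = c * ceval_at z p.
Proof. exact: mevalZ. Qed.

Lemma ceval_rcst z x : ceval_at z (rcst n x) = x%:C.
Proof. by rewrite ceval_scale rmorph1 mulr1. Qed.

Lemma ceval_cst z c : ceval_at z (cst n c) = c.
Proof. by rewrite ceval_scale rmorph1 mulr1. Qed.

Definition real_point (e : seq R) : cspace R n :=
  \row_j ((e`_j +i* e`_(n + j) : R[i]) : (R[i])^o).

Lemma ceval_re_var e j : ceval_at (real_point e) (re_var R j) = (e`_j)%:C.
Proof.
rewrite ceval_scale rmorphD ceval_varX ceval_varY mxE.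
apply/eqP; rewrite eq_complex /=.
by apply/andP; split; apply/eqP; field.
Qed.

Lemma ceval_im_var e j : ceval_at (real_point e) (im_var R j) = (e`_(n + j))%:C.
Proof.
rewrite ceval_scale rmorphB ceval_varX ceval_varY mxE.
apply/eqP; rewrite eq_complex /=.
by apply/andP; split; apply/eqP; field.
Qed.

Lemma ceval_coords e i : (i < n + n)%N ->
  ceval_at (real_point e) ((coords R n)`_i) = (e`_i)%:C.
Proof.
move=> lt; have [ltn|le] := ltnP i n.
  by rewrite (coords_re R (Ordinal ltn)) ceval_re_var.
have lt' : (i - n < n)%N by rewrite ltn_subLR.
by have := coords_im R (Ordinal lt'); rewrite /= subnKC // => ->;
  rewrite ceval_im_var /= subnKC.
Qed.

(** The value being real, a polynomial split by [param_split] vanishes at the point exactly when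
    both of its terms do. *)
Lemma ceval_param_eval e params t :
  (forall j, (n + n <= j)%N -> e`_j = params`_(j - (n + n))) ->
  ceval_at (real_point e) (param_eval (rcst n) (coords R n) params t) =
    (teval (@ratr R) e t)%:C.
Proof.
move=> he; rewrite /param_eval.
pose h := @real_complex R \o @ratr R.
rewrite (@rmorph_teval _ _ _ _ h) => [|q]; last exact: ceval_rcst.
rewrite [RHS](@rmorph_teval _ _ (@real_complex R) _ h) //.
apply: eq_teval => // i.
have -> : (map (@real_complex R) e)`_i = (e`_i)%:C.
  have [lt|le] := ltnP i (size e); first by rewrite (nth_map 0).
  by rewrite !nth_default ?size_map.
have sc := size_coords R n.
have [lt|le] := ltnP i (n + n).
  by rewrite map_cat nth_cat size_map sc lt (nth_map 0) ?sc // ceval_coords.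
rewrite map_cat nth_cat size_map sc ltnNge le /= he // -map_comp.
have [lt|le'] := ltnP (i - (n + n)) (size params).
  by rewrite (nth_map 0) //= ceval_rcst.
by rewrite !nth_default ?size_map.
Qed.

End Evaluation.

(** * Zero sets and kernels of positive functionals *)

Section Main.
Local Open Scope complex_scope.
Local Open Scope ring_scope.
Variables (R : realType) (n : nat).

Lemma zero_set_null_elt (L : {scalar (cpoly R n)}) (P Q : cpoly R n) :
  positive_definite L -> zero_set Q `<=` zero_set P -> null_elt L Q -> null_elt L P.
Proof.
move=> Lpos QP NQ; apply: contrapT => NP.
(* [P] is split with the parameters of [Q] as prefix, so that the single list [c1 ++ c2] serves both
   polynomials. *)
have [c1 [q1 [q2 hQ]]] := cpoly_param_split Q [::].
have [c2 [p1 [p2 hP]]] := cpoly_param_split P c1.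
have {}hQ := hQ c2; have {}hP := hP [::]; rewrite cats0 in hP; rewrite cat0s in hQ.
have [e [he [eq1 eq2 ep]]] := rcf_real_point (@cstarD R n) (@cstarM R n) (@cstarZ R n)
   (@cstarK R n) Lpos (@cstar_rcst R n) (@cst_i2 R n) (@cstar_i R n) (@cstar_coords R n)
   hP hQ NQ NP.
rewrite size_coords in he.
have zQ : zero_set Q (real_point n e).
  rewrite /zero_set /= ceval_atE hQ rmorphD rmorphM !ceval_param_eval //.
  by rewrite eq1 eq2 mulr0 addr0.
have := QP _ zQ; rewrite /zero_set /= ceval_atE hP rmorphD rmorphM !ceval_param_eval //.
rewrite ceval_cst => /eqP; rewrite eq_complex /=.
rewrite !(mul0r, mul1r, mulr0, subr0, addr0, add0r, oppr0) => /andP[/eqP E1 /eqP E2].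
by move: ep; rewrite E1 E2 expr0n /= addr0 ltxx.
Qed.

(** Nullity of [Q] is exactly the inclusion of its ideal in the kernel of [L], and likewise for [P];
    the measure that type A of [P] provides then serves for [Q] unchanged. *)
Lemma type_A_zero_set (P Q : cpoly R n) : zero_set P = zero_set Q -> type_A P -> type_A Q.
Proof.
move=> PQ AP L Lpos LQ; apply: AP => // _ [s _ <-] /=.
apply: (@zero_set_null_elt L P Q) => //; first by rewrite PQ.
by move=> u; apply: LQ; exists u.
Qed.

End Main.

Theorem theorem8p1 (R : realType) (n : nat) (hn : (1 <= n)%N)
    (P Q : cpoly R n) (hPQ : zero_set P = zero_set Q) :
  type_A P <-> type_A Q.
Proof. by split; apply: type_A_zero_set. Qed.
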